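(* Let $d\ge 1$. Assume that $(F_n)_{n\ge 1}$ is a sequence of distribution functions such that $F_n\in\mathcal{D}$ for all $n$, $F_n\stackrel{w}{\to}F$, $F\in\mathcal{D}$, and $F$ assigns probability $1$ to $[0,+\infty)$. If $d=2$, suppose furthermore that there exists a constant $\lambda>0$ such that $F_n(\lambda)=0$ for all $n$. Then $\lim_{n\to\infty}\beta_{F_n}(x)=\beta_F(x)$ for all $x\in\mathbb{Z}^d$.
   Context: $(S_n)_{n\ge 0}$ is the simple (symmetric, nearest-neighbour) random walk on $\mathbb{Z}^d$; $P_x,E_x$ denote its law and expectation when started at $x$. Independently of the walk, the potential $V(x,\omega)$, $x\in\mathbb{Z}^d$, is a family of i.i.d. non-negative random variables with distribution function $F$, defined on a probability space $(\Omega,\mathcal{F},\mathbb{P})$ with expectation $\mathbb{E}$. $\mathcal{D}$ is the set of distribution functions $F$ which assign zero measure to $(-\infty,0)$ and satisfy $F(0)<1$ (no finite mean is required). $F_n\stackrel{w}{\to}F$ denotes weak convergence (convergence in distribution). For $y\in\mathbb{Z}^d$, $H(y)=\inf\{n\ge 0:S_n=y\}$ (with $\inf\emptyset=+\infty$). For $x,y\in\mathbb{Z}^d$, $e(x,y,\omega)=E_x\big[\exp(-\sum_{m=0}^{H(y)-1}V(S_m,\omega))\mathbf{1}_{\{H(y)<\infty\}}\big]$ (equal to $1$ if $x=y$), and $b(x,y)=-\ln\mathbb{E}[e(x,y,\omega)]$. Annealed Lyapunov exponent: for $F\in\mathcal{D}$ and $x\in\mathbb{Z}^d$, $\beta_F(x)=\lim_{n\to\infty}\frac1n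 b(0,nx)=\inf_{n\ge1}\frac1n b(0,nx)$, where the potential has distribution function $F$ (it is a known theorem that this limit exists). *)

(* Defs.v *)
(* MathComp / MathComp-Analysis. *)
From HB Require Import structures.
From mathcomp Require Import all_boot all_order all_algebra.
From mathcomp Require Import all_classical all_reals all_analysis.

Set Implicit Arguments.
Unset Strict Implicit.
Unset Printing Implicit Defensive.

Import Order.TTheory GRing.Theory Num.Theory.
Import numFieldNormedType.Exports.

Local Open Scope classical_set_scope.
Local Open Scope ring_scope.

(* One step of the simple random walk: uniform on the 2d vectors +e_i, -e_i. *)
Definition srw_step (R : realType) (d : nat) (u : 'rV[int]_d) : R :=
  if [exists i : 'I_d, (u == delta_mx 0 i) || (u == - delta_mx 0 i)]
  then (2 * d%:R)^-1 else 0.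

(* The simple random walk with its laws P_x on a common space.  'rV[int]_d
   carries no sigma-algebra, so measurability of S_n is stated on singletons,
   which suffices since Z^d is countable.  The fourth axiom, for all n and u,
   says that the increments are i.i.d. with law srw_step. *)
Record srw (R : realType) (d : nat) := Srw {
  walk_display : measure_display ;
  walk_space : measurableType walk_display ;
  walk_law : 'rV[int]_d -> probability walk_space R ;
  walk_pos : nat -> walk_space -> 'rV[int]_d ;
  walk_measurable : forall n z, measurable [set w | walk_pos n w = z] ;
  walk_start : forall x, walk_law x [set w | walk_pos 0 w = x] = 1%E ;
  walk_steps : forall x n (u : 'I_n -> 'rV[int]_d),
    walk_law x [set w | forall i : 'I_n,
                  walk_pos i.+1 w - walk_pos i w = u i] =
    (\prod_(i < n) srw_step R (u i))%:E
}.

Definition mutually_independent (R : realType) (I : choiceType)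
    (dO : measure_display) (Om : measurableType dO) (Q : probability Om R)
    (X : I -> {RV Q >-> R}) : Prop :=
  forall (s : seq I) (B : I -> set R), uniq s ->
    (forall i, measurable (B i)) ->
    fine (Q [set w | forall i, i \in s -> B i (X i w)]) =
    \prod_(i <- s) fine (Q [set w | B i (X i w)]).

(* A realisation of the i.i.d. non-negative potential whose one-site
   distribution function is F. *)
Record iid_potential (R : realType) (d : nat)
    (F : cumulativeBounded (0 : R) (1 : R)) := IidPotential {
  pot_display : measure_display ;
  pot_space : measurableType pot_display ;
  pot_law : probability pot_space R ;
  pot : 'rV[int]_d -> {RV pot_law >-> R} ;
  pot_ge0 : forall z w, 0 <= pot z w ;
  pot_independent : mutually_independent pot ;
  pot_cdf : forall z t, cdf (pot z) t = (F t)%:E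
}.

(* The class D.  Being a distribution function (non-decreasing,
   right-continuous, with limits 0 at -oo and 1 at +oo) is carried by the type
   of F; lebesgue_stieltjes_measure F is the law it determines. *)
Definition in_D (R : realType) (F : cumulativeBounded (0 : R) (1 : R)) : Prop :=
  lebesgue_stieltjes_measure F `]-oo, 0[ = 0%E /\ F 0 < 1.

Definition cvg_weakly (R : realType) (F_ : nat -> R -> R) (F : R -> R) : Prop :=
  forall t : R, {for t, continuous F} -> F_ n t @[n --> \oo] --> F t.

(* H(y) along the trajectory s; None stands for +oo. *)
Definition hitting_time (d : nat) (s : nat -> 'rV[int]_d) (y : 'rV[int]_d) :
    option nat :=
  match pselect (exists n, s n == y) with
  | left hit => Some (ex_minn hit)
  | right _ => None
  end.

(* The variable under E_x in e(x,y,omega), for the frozen potential v. *)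
Definition survival (R : realType) (d : nat) (v : 'rV[int]_d -> R)
    (s : nat -> 'rV[int]_d) (y : 'rV[int]_d) : R :=
  match hitting_time s y with
  | Some h => expR (- \sum_(m < h) v (s m))
  | None => 0
  end.

(* e(x,y,omega), with v = V(.,omega). *)
Definition travel_weight (R : realType) (d : nat) (W : srw R d)
    (v : 'rV[int]_d -> R) (x y : 'rV[int]_d) : R :=
  fine 'E_(walk_law W x)[fun w => survival v (fun n => walk_pos n w) y].

(* b(x,y).  The walk and the potential live on separate spaces and are
   integrated in turn, which is their independence. *)
Definition annealed_cost (R : realType) (d : nat) (W : srw R d)
    (F : cumulativeBounded (0 : R) (1 : R)) (V : iid_potential d F)
    (x y : 'rV[int]_d) : R :=
  - ln (fine 'E_(pot_law V)[fun w => travel_weight W (fun z => pot V z w) x y]).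

(* beta_F(x), computed in the realisations W and V; it depends on V only
   through F. *)
Definition annealed_lyapunov (R : realType) (d : nat) (W : srw R d)
    (F : cumulativeBounded (0 : R) (1 : R)) (V : iid_potential d F)
    (x : 'rV[int]_d) : R :=
  limn (fun n : nat => annealed_cost W V 0 (x *+ n) / n%:R).

(* Main.v *)
Require Import Defs.
From HB Require Import structures.
From mathcomp Require Import all_boot all_order all_algebra.
From mathcomp Require Import all_classical all_reals all_analysis.
From mathcomp Require Import ring lra zify.
Import Order.TTheory GRing.Theory Num.Theory.
Import numFieldNormedType.Exports.
Local Open Scope classical_set_scope.
Local Open Scope ring_scope.

Set Implicit Arguments.
Unset Strict Implicit.
Unset Printing Implicit Defensive.

(** Summing out the walk and the potential turns [exp (- b(0, y))] into a sum over
    the words of steps that lead from [0] to a first visit of [y].  A word [s] has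
    weight [(2 d)^-|s|] times the product, over the sites that it visits, of
    [g l], where [l] is the number of visits and [g l = E exp (- l V)] is the
    Laplace transform of the one-site law ([annealed_costE]).  The law enters only
    through the sequence [g], convergence in distribution gives pointwise
    convergence of these sequences ([cvg_laplace]), and the theorem becomes the
    continuity of the exponent in [g] ([lyapunov_continuous]).  Write [mass g y]
    for the sum over words and [beta g] for the exponent.

    Upper bound.  Since [g j * g k <= g (j + k)], concatenating paths makes
    [- ln (mass g (n x))] subadditive in [n], so that [beta g] is an infimum over
    [n], and over truncations of the sum, of continuous functions of [g]
    ([lyapunov_usc]).

    Lower bound, two dimensions or more.  If [g_n <= g ^ t] for some [t < 1],
    Jensen's inequality gives [mass g_n <= (mass g) ^ t], and the exponent of
    [g_n] is at least [t] times that of [g].  As [g l < 1] for [l > 0], pointwise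
    convergence yields this domination for any bounded number of visits, and for
    all numbers when [g] has a positive limit.  Otherwise [g] tends to [0], while
    [g_n] may keep a positive limit, and sites with at least [L] visits have to be
    treated differently.  From a path with at least [L] visits to a site one cuts
    out the loop between the visit number [L] and the last one ([excise_site]).
    The loops that may have been there have total mass [G], a Green function that
    does not depend on [L], and for large [L] the gap between [g L] and
    [g L ^ t] is larger than the factor [G].  Finiteness of [G] comes from
    transience for [d >= 3], shown with a superharmonic function
    ([loops_transient]), and for [d = 2] from the lower bound on the potential:
    a small power of [g_n] is spent on killing the walk at a constant rate.

    Lower bound on the line.  Here loops are not summable, but the walk meets the
    sites in order.  If only the visits to the sites between [0] and the target
    are charged, cutting a path at its first visit to an intermediate site shows
    that the resulting mass is submultiplicative in the distance
    ([strip_passageM]), so that a bound at one distance [m] is enough, where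
    continuity in [g] is clear.  Excising the loops at the origin shows that this
    mass exceeds [mass g] at most by the factor [2 m] ([strip_passage_le_mass]),
    which is negligible on the exponential scale. *)

(** * Words of steps and the paths they trace *)

Notation step d := ('I_d * bool)%type.

Definition step_vec d (u : step d) : 'rV[int]_d :=
  if u.2 then - delta_mx 0 u.1 else delta_mx 0 u.1.

Fixpoint dest d (x : 'rV[int]_d) (s : seq (step d)) : 'rV[int]_d :=
  if s is u :: t then dest (x + step_vec u) t else x.

(** The endpoint is left out: the potential is not paid at the hitting time. *)
Fixpoint trace d (x : 'rV[int]_d) (s : seq (step d)) : seq 'rV[int]_d :=
  if s is u :: t then x :: trace (x + step_vec u) t else [::].

Definition first_hit d (x y : 'rV[int]_d) (s : seq (step d)) : bool :=
  (dest x s == y) && (y \notin trace x s).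

(** The law of the first [n] increments of the walk, as a finite mean that needs
    no probability space. *)
Fixpoint avg (R : realType) d n (f : seq (step d) -> R) : R :=
  if n is m.+1 then (2 * d%:R)^-1 * \sum_(u : step d) avg m (fun s => f (u :: s))
  else f [::].

(** [h z l] is the factor contributed by [l] visits to [z].  It depends on the
    site in order that the sites can be treated one at a time. *)
Definition weight (R : realType) d (h : 'rV[int]_d -> nat -> R)
    (l : seq 'rV[int]_d) : R :=
  \prod_(z <- undup l) h z (count_mem z l).

Section words.
Context {R : realType} {d : nat}.
Implicit Types (x y z : 'rV[int]_d) (s t : seq (step d)).
Implicit Types (f g : seq (step d) -> R).

Lemma dest_cat x s t : dest x (s ++ t) = dest (dest x s) t.
Proof. by elim: s x => //= u s IH x; rewrite IH. Qed.

Lemma trace_cat x s t : trace x (s ++ t) = trace x s ++ trace (dest x s) t.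
Proof. by elim: s x => //= u s IH x; rewrite IH. Qed.

Lemma size_trace x s : size (trace x s) = size s.
Proof. by elim: s x => //= u s IH x; rewrite IH. Qed.

Lemma dest_shift x v s : dest (x + v) s = dest x s + v.
Proof. by elim: s x => //= u s IH x; rewrite addrAC IH. Qed.

Lemma trace_shift x v s : trace (x + v) s = [seq z + v | z <- trace x s].
Proof. by elim: s x => //= u s IH x; rewrite addrAC IH. Qed.

Lemma first_hit_shift x y v s : first_hit (x + v) (y + v) s = first_hit x y s.
Proof.
rewrite /first_hit dest_shift trace_shift (inj_eq (addIr v)).
by have /= -> := mem_map (addIr v) (trace x s) y.
Qed.

Lemma ler_avg n f g : (forall s, size s = n -> f s <= g s) ->
  avg n f <= avg n g.
Proof.
elim: n f g => [|n IH] f g fg /=; first exact: fg.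
apply: ler_wpM2l; first by rewrite invr_ge0 mulr_ge0 // ler0n.
by apply: ler_sum => u _; apply: IH => s ss; apply: fg; rewrite /= ss.
Qed.

Lemma eq_avg n f g : (forall s, size s = n -> f s = g s) -> avg n f = avg n g.
Proof.
by move=> fg; apply/eqP; rewrite eq_le; apply/andP; split; apply: ler_avg => s /fg ->.
Qed.

Lemma avgZ n a f : avg n (fun s => a * f s) = a * avg n f.
Proof.
elim: n f => [//|n IH] f /=.
by under eq_bigr do rewrite IH; rewrite -mulr_sumr mulrCA.
Qed.

Lemma avgD n f g : avg n (fun s => f s + g s) = avg n f + avg n g.
Proof.
elim: n f g => [//|n IH] f g /=.
by under eq_bigr do rewrite IH; rewrite big_split /= mulrDr.
Qed.

Lemma avg0 n : avg n (fun _ : seq (step d) => 0 : R) = 0.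
Proof.
transitivity (avg n (fun _ : seq (step d) => 0 * 0 : R)).
  by apply: eq_avg => s _; rewrite mul0r.
by rewrite avgZ mul0r.
Qed.

Lemma avg_sum n (I : Type) (r : seq I) (P : pred I) (F : I -> seq (step d) -> R) :
  avg n (fun s => \sum_(i <- r | P i) F i s) = \sum_(i <- r | P i) avg n (F i).
Proof.
elim: r => [|i r IH].
  rewrite big_nil -[RHS](avg0 n).
  by apply: eq_avg => s _; rewrite big_nil.
rewrite big_cons -IH; case: ifP => Pi.
  by rewrite -avgD; apply: eq_avg => s _; rewrite big_cons Pi.
by apply: eq_avg => s _; rewrite big_cons Pi.
Qed.

Lemma avg_ge0 n f : (forall s, size s = n -> 0 <= f s) -> 0 <= avg n f.
Proof. by move=> f0; rewrite -(avg0 n); apply: ler_avg. Qed.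

Lemma avg_cat m n f :
  avg (m + n) f = avg m (fun s => avg n (fun t => f (s ++ t))).
Proof.
elim: m f => [//|m IH] f /=; congr (_ * _); apply: eq_bigr => u _.
exact: IH.
Qed.

Lemma avg1 n : (0 < d)%N -> avg n (fun _ : seq (step d) => 1 : R) = 1.
Proof.
move=> d0; elim: n => [//|n IH] /=; rewrite IH sumr_const card_prod card_ord.
rewrite card_bool mulrC -mulr_natl mulr1 natrM [_ * 2]mulrC mulfV //.
by rewrite mulf_neq0 // pnatr_eq0 -lt0n.
Qed.

Lemma avg_tuple n f :
  avg n f = (2 * d%:R)^-1 ^+ n * \sum_(t : n.-tuple (step d)) f t.
Proof.
elim: n f => [|n IH] f /=.
  rewrite expr0 mul1r (big_pred1 [tuple]) // => w; apply/esym/eqP.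
  exact: tuple0.
rewrite exprS -mulrA; congr (_ * _).
under eq_bigr do rewrite IH.
rewrite -mulr_sumr; congr (_ * _).
rewrite pair_big /= (reindex (fun p : step d * n.-tuple (step d) => [tuple of p.1 :: p.2])) //=.
exists (fun w : n.+1.-tuple (step d) => (thead w, [tuple of behead w])) => [[u w] _ /=|w _].
  by rewrite theadE; congr pair; apply: val_inj.
by apply: val_inj; rewrite [in RHS](tuple_eta w).
Qed.

(** The increments before and after time [i] are independent.  A function of a
    word that is dominated by a sum over its factorisations is thus dominated in
    the mean by products of means. *)
Lemma avg_splits n (q : nat -> seq (step d) -> seq (step d) -> R) :
  avg n (fun s => \sum_(i < n.+1) q i (take i s) (drop i s)) =
  \sum_(i < n.+1) avg i (fun a => avg (n - i) (fun b => q i a b)).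
Proof.
rewrite avg_sum; apply: eq_bigr => i _.
rewrite -[X in avg X _](subnKC (_ : i <= n)%N); last by rewrite -ltnS.
rewrite avg_cat; apply: eq_avg => a sa; apply: eq_avg => b sb.
by rewrite take_size_cat // drop_size_cat.
Qed.

End words.

Lemma sum_triangle (R : realType) N (F : nat -> nat -> R) :
  \sum_(n < N) \sum_(i < n.+1) F i (n - i)%N =
  \sum_(i < N) \sum_(k < N - i) F i k.
Proof.
elim: N => [|N IH]; first by rewrite !big_ord0.
rewrite big_ord_recr /= IH [RHS]big_ord_recr /= subSn // subnn big_ord1.
rewrite big_ord_recr /= subnn addrA; congr (_ + _).
rewrite -big_split /=; apply: eq_bigr => i _.
by rewrite subSn ?big_ord_recr //= ltnW.
Qed.

Lemma ler_sum_widen (R : realType) m n (F : nat -> R) : (m <= n)%N ->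
  (forall k, 0 <= F k) -> \sum_(k < m) F k <= \sum_(k < n) F k.
Proof.
by move=> mn F0; rewrite -(subnKC mn) big_split_ord /= lerDl sumr_ge0.
Qed.
(** * Weights of local times *)

(** [g l] is meant as the factor that [l] visits contribute to a weight. *)
Definition discount (R : realType) (g : nat -> R) : Prop :=
  [/\ g 0%N = 1, forall l, 0 <= g l & forall k l, (k <= l)%N -> g l <= g k].

Section weights.
Context {R : realType} {d : nat}.
Implicit Types (z : 'rV[int]_d) (l : seq 'rV[int]_d).
Implicit Types (h : 'rV[int]_d -> nat -> R) (g : nat -> R).

Lemma discount_le1 g k : discount g -> g k <= 1.
Proof. by case=> g0 _ gm; rewrite -g0; apply: gm. Qed.

(** Over a list [r] that covers two paths their weights can be compared factor by
    factor. *)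
Lemma weightE h l r : (forall z, h z 0%N = 1) -> uniq r -> {subset l <= r} ->
  weight h l = \prod_(z <- r) h z (count_mem z l).
Proof.
move=> h0 ur lr; rewrite /weight [RHS](bigID (mem l)) /=.
rewrite [X in _ = _ * X]big1 ?mulr1; last first.
  by move=> z zl; rewrite (count_memPn zl) h0.
rewrite -[RHS]big_filter; apply: perm_big; apply: uniq_perm.
- exact: undup_uniq.
- exact: filter_uniq.
- by move=> z; rewrite mem_undup mem_filter; case: (boolP (z \in l)) => // /lr ->.
Qed.

Lemma weight_ge0 h l : (forall z, discount (h z)) -> 0 <= weight h l.
Proof. by move=> hc; apply: prodr_ge0 => z _; case: (hc z). Qed.

Lemma weight_le1 h l : (forall z, discount (h z)) -> weight h l <= 1.
Proof.
move=> hc; rewrite /weight; elim: (undup l) => [|z r IH]; first by rewrite big_nil.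
rewrite big_cons mulr_ile1 // ?discount_le1 //; first by case: (hc z).
by apply: prodr_ge0 => w _; case: (hc w).
Qed.

Lemma ler_weight h h' l : (forall z k, 0 <= h z k) ->
  (forall z k, z \in l -> h z k <= h' z k) -> weight h l <= weight h' l.
Proof.
move=> h0 hh'; rewrite /weight !big_seq; apply: ler_prod => z.
by rewrite mem_undup => zl; rewrite h0 hh'.
Qed.

Lemma weight_anti h l l' : (forall z, discount (h z)) ->
  (forall z, (count_mem z l <= count_mem z l')%N) -> weight h l' <= weight h l.
Proof.
move=> hc cl.
have h0 z : h z 0%N = 1 by case: (hc z).
have sub : {subset l <= undup l'}.
  by move=> z; rewrite mem_undup -!has_pred1 !has_count => /leq_trans; apply.
rewrite (weightE h0 (undup_uniq l') sub).
rewrite (weightE h0 (undup_uniq l') (_ : {subset l' <= _})).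
  by apply: ler_prod => z _; case: (hc z) => _ -> /= ->.
by move=> z; rewrite mem_undup.
Qed.

Lemma weight_cat_ge h l l' : (forall z, discount (h z)) ->
  (forall z j k, h z j * h z k <= h z (j + k)%N) ->
  weight h l * weight h l' <= weight h (l ++ l').
Proof.
move=> hc hM.
have h0 z : h z 0%N = 1 by case: (hc z).
pose r := undup (l ++ l').
have ur : uniq r by exact: undup_uniq.
have s1 : {subset l <= r} by move=> z zl; rewrite mem_undup mem_cat zl.
have s2 : {subset l' <= r} by move=> z zl; rewrite mem_undup mem_cat zl orbT.
have s3 : {subset l ++ l' <= r} by move=> z; rewrite mem_undup.
rewrite (weightE h0 ur s1) (weightE h0 ur s2) (weightE h0 ur s3) -big_split /=.
apply: ler_prod => z _; rewrite count_cat hM andbT mulr_ge0 //; by case: (hc z).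
Qed.

Lemma weight_shift g v l :
  weight (fun _ => g) [seq z + v | z <- l] = weight (fun _ => g) l.
Proof.
rewrite /weight undup_map_inj; last exact: addIr.
rewrite big_map; apply: eq_bigr => z _; rewrite count_map.
by congr g; apply: eq_count => w /=; rewrite (inj_eq (addIr v)).
Qed.

Lemma weight_powR g (t : R) l : (forall k, 0 <= g k) ->
  weight (fun _ k => g k `^ t) l = weight (fun _ => g) l `^ t.
Proof.
move=> g0; rewrite /weight; elim: (undup l) => [|z r IH].
  by rewrite !big_nil powR1.
by rewrite !big_cons IH powRM // prodr_ge0.
Qed.

End weights.

(** * First passages *)

(** Truncated in the length of the words, so that every sum is finite. *)
Definition passage (R : realType) d N (x y : 'rV[int]_d)
    (f : seq (step d) -> R) : R :=
  \sum_(n < N) avg n (fun s => (first_hit x y s)%:R * f s).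

Section passages.
Context {R : realType} {d : nat}.
Implicit Types (x y z : 'rV[int]_d) (s t : seq (step d)).
Implicit Types (f g : seq (step d) -> R).

Lemma ler_passage N x y f g :
  (forall s, (size s < N)%N -> first_hit x y s -> f s <= g s) ->
  passage N x y f <= passage N x y g.
Proof.
move=> fg; apply: ler_sum => n _; apply: ler_avg => s sn.
by case: (boolP (first_hit x y s)) => [/fg|]; rewrite ?mul0r // !mul1r sn; apply.
Qed.

Lemma eq_passage N x y f g :
  (forall s, (size s < N)%N -> first_hit x y s -> f s = g s) ->
  passage N x y f = passage N x y g.
Proof.
by move=> fg; apply/eqP; rewrite eq_le; apply/andP; split; apply: ler_passage => s sN /fg ->.
Qed.

Lemma passage_ge0 N x y f : (forall s, 0 <= f s) -> 0 <= passage N x y f.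
Proof. by move=> f0; apply: sumr_ge0 => n _; apply: avg_ge0 => s _; rewrite mulr_ge0. Qed.

Lemma passageZ N x y a f :
  passage N x y (fun s => a * f s) = a * passage N x y f.
Proof.
rewrite /passage mulr_sumr; apply: eq_bigr => n _; rewrite -avgZ.
by apply: eq_avg => s _; rewrite mulrCA.
Qed.

Lemma passage_cst N x y (a : R) :
  passage N x y (fun _ => a) = a * passage N x y (fun _ => 1).
Proof. by rewrite -passageZ; apply: eq_passage => s _ _; rewrite mulr1. Qed.

Lemma passageD N x y f g :
  passage N x y (fun s => f s + g s) = passage N x y f + passage N x y g.
Proof.
rewrite /passage -big_split /=; apply: eq_bigr => n _; rewrite -avgD.
by apply: eq_avg => s _; rewrite mulrDr.
Qed.

Lemma passage_shift N x y v f :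
  passage N (x + v) (y + v) f = passage N x y f.
Proof.
by apply: eq_bigr => n _; apply: eq_avg => s _; rewrite first_hit_shift.
Qed.

Lemma passage_nondecreasing x y f M N : (forall s, 0 <= f s) -> (M <= N)%N ->
  passage M x y f <= passage N x y f.
Proof.
move=> f0 MN; rewrite /passage -(subnKC MN) big_split_ord /= lerDl.
by apply: sumr_ge0 => n _; apply: avg_ge0 => s _; rewrite mulr_ge0.
Qed.

Lemma passage_recl N x y f : passage N.+1 x y f =
  if x == y then f [::] else
  (2 * d%:R)^-1 * \sum_(u : step d) passage N (x + step_vec u) y (fun s => f (u :: s)).
Proof.
have fh u s : first_hit x y (u :: s) = (x != y) && first_hit (x + step_vec u) y s.
  by rewrite /first_hit /= in_cons negb_or [y == x]eq_sym andbCA.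
rewrite /passage big_ord_recl /= {1}/first_hit /= andbT.
case: eqP => xy /=; rewrite ?mul1r ?mul0r ?add0r.
  rewrite big1 ?addr0 // => n _; rewrite big1 ?mulr0 // => u _.
  by rewrite -[RHS](avg0 (d := d) n); apply: eq_avg => s _; rewrite fh xy eqxx mul0r.
rewrite -mulr_sumr exchange_big /=; congr (_ * _); apply: eq_bigr => u _.
apply: eq_bigr => n _; apply: eq_avg => s _; rewrite fh.
by move/eqP: xy => ->.
Qed.

(** The first visits to [y] at different times exclude each other; in terms of
    words this is an induction on the first step. *)
Lemma passage_le1 N x y : (0 < d)%N -> passage N x y (fun _ => 1 : R) <= 1.
Proof.
move=> d0; elim: N x => [|N IH] x; first by rewrite /passage big_ord0.
rewrite passage_recl; case: eqP => // _.
rewrite -[leRHS](avg1 (R := R) 1 d0) /=; apply: ler_wpM2l.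
  by rewrite invr_ge0 mulr_ge0.
by apply: ler_sum.
Qed.

(** Jensen's inequality for the concave map [t |-> t `^ a], which applies since
    first passages have total mass at most one. *)
Lemma passage_powR N x y f (a c : R) : (0 < d)%N -> (forall s, 0 <= f s) ->
  0 < a < 1 -> 0 < c -> passage N x y f <= c ->
  passage N x y (fun s => f s `^ a) <= c `^ a.
Proof.
move=> d0 f0 /andP[a0 a1] c0 fc.
have b0 : 0 < 1 - a by rewrite subr_gt0.
(* the tangent of [t |-> t `^ a] at [c] lies above the graph *)
have young s : f s `^ a <= c `^ (a - 1) * (a * f s) + c `^ (a - 1) * ((1 - a) * c).
  have := @conjugate_powR R (f s `^ a) (c `^ (1 - a)) a^-1 (1 - a)^-1
    (powR_ge0 _ _) (powR_ge0 _ _).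
  rewrite !invr_gt0 !invrK => /(_ a0 b0).
  rewrite addrC subrK -!powRrM !mulfV ?gt_eqF // !powRr1 // ?(ltW c0) //.
  move=> /(_ erefl) H.
  rewrite -mulrDr -ler_pdivrMl ?powR_gt0 // -powRN opprB mulrC.
  by rewrite [a * _]mulrC [(1 - a) * _]mulrC.
apply: (le_trans (ler_passage (fun s _ _ => young s))).
have [k kE] : exists k, k = c `^ (a - 1) * ((1 - a) * c) by eexists.
rewrite -kE.
have -> : passage N x y (fun s => c `^ (a - 1) * (a * f s) + k) =
    c `^ (a - 1) * (a * passage N x y f) + k * passage N x y (fun _ => 1).
  by rewrite passageD !passageZ -passage_cst.
have -> : c `^ a = c `^ (a - 1) * (a * c) + k.
  rewrite kE; have -> : c `^ a = c `^ (a - 1) * c.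
    rewrite -[X in _ * X](powRr1 (ltW c0)) -powRD ?subrK //.
    by rewrite (gt_eqF c0) implybT.
  ring.
apply: lerD.
  by rewrite ler_wpM2l ?powR_ge0 // ler_wpM2l // ltW.
rewrite ler_piMr ?passage_le1 // kE !mulr_ge0 ?powR_ge0 //; exact: ltW.
Qed.

End passages.
(** * Excising loops *)

Section excision.
Context {R : realType} {d : nat}.
Implicit Types (x y z : 'rV[int]_d) (s t a b c : seq (step d)).

Lemma visit_split z s x k : (k < count_mem z (trace x s))%N ->
  exists a c, [/\ s = a ++ c, dest x a = z & count_mem z (trace x a) = k].
Proof.
elim: s x k => [//|u s IH] x k /=.
have [xz|xz] := eqVneq x z; last first.
  rewrite add0n => /IH[a [c [-> da ca]]]; exists (u :: a), c; split => //=.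
  by rewrite (negbTE xz) add0n.
case: k => [_|k]; first by exists [::], (u :: s).
rewrite add1n ltnS => /IH[a [c [-> da ca]]]; exists (u :: a), c; split => //=.
by rewrite ca xz eqxx.
Qed.

(** The middle part [b] is the loop that excision removes: it leads from the visit
    number [k], counted from [1], to the last visit. *)
Lemma loop_split z s x k : (0 < k <= count_mem z (trace x s))%N ->
  exists a b c, [/\ s = a ++ b ++ c, dest x a = z,
    count_mem z (trace x a) = k.-1, dest z b = z & count_mem z (trace z c) = 1%N].
Proof.
case: k => // k /= kc.
have [a [t [st da ca]]] := visit_split kc.
have ct : (count_mem z (trace x s) = k + count_mem z (trace z t))%N.
  by rewrite st trace_cat count_cat ca da.
have jt : ((count_mem z (trace z t)).-1 < count_mem z (trace z t))%N.
  by rewrite ct in kc; case: (count_mem z (trace z t)) kc; rewrite ?addn0 ?ltnn.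
have [b [c [tt db cb]]] := visit_split jt.
exists a, b, c; rewrite st tt; split => //.
have : count_mem z (trace z t) = ((count_mem z (trace z t)).-1 + count_mem z (trace z c))%N.
  by rewrite [in LHS]tt trace_cat count_cat db cb.
by move: jt; move: (count_mem z (trace z t)) (count_mem z (trace z c)) => p q; lia.
Qed.

(** The Green function at [z], truncated at length [N], of the walk that survives
    each step with probability [kappa] and is killed at [y]. *)
Definition loops (kappa : R) N z y (x : 'rV[int]_d) : R :=
  \sum_(n < N) avg n (fun s => ((dest x s == z) && (y \notin trace x s))%:R
                               * kappa ^+ size s).

(** Along the walk [f] decreases in the mean, by at least [1] at each visit to [z],
    and it stays nonnegative; so [f x] bounds the mean number of visits.  In terms
    of words this is an induction on the first step. *)
Lemma loops_le_superharmonic (kappa : R) (f : 'rV[int]_d -> R) z y : 0 <= kappa ->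
  z != y -> (forall x, 0 <= f x) ->
  (forall x, x != y ->
    (x == z)%:R + kappa * ((2 * d%:R)^-1 * \sum_(u : step d) f (x + step_vec u)) <= f x) ->
  forall N x, loops kappa N z y x <= f x.
Proof.
move=> k0 zy f0 fsup; elim=> [|N IH] x; first by rewrite /loops big_ord0.
rewrite /loops big_ord_recl /= expr0 mulr1 andbT.
have [xy|xy] := eqVneq x y.
  rewrite xy eq_sym (negbTE zy) add0r big1 // => n _.
  rewrite big1 ?mulr0 // => u _; rewrite -[RHS](avg0 (d := d) n).
  by apply: eq_avg => s _; rewrite in_cons eqxx /= andbF mul0r.
apply: le_trans (fsup x xy); rewrite lerD2l -mulr_sumr mulrCA ler_wpM2l //.
rewrite exchange_big mulr_sumr /=; apply: ler_sum => u _.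
apply: le_trans (ler_wpM2l k0 (IH (x + step_vec u))).
rewrite /loops mulr_sumr; apply: ler_sum => n _; rewrite -avgZ.
apply: ler_avg => s _; rewrite in_cons [y == x]eq_sym (negbTE xy) /= exprS.
by rewrite mulrCA.
Qed.

Section one_site.
Variables (N : nat) (x y z0 : 'rV[int]_d) (h : 'rV[int]_d -> nat -> R).
Variables (g' : nat -> R) (kappa G : R) (L : nat).
Hypothesis hc : forall z, discount (h z).
Hypothesis g'0 : forall k, 0 <= g' k.
Hypothesis g'1 : g' 0%N = 1.
Hypothesis hg' : forall k, (k < L)%N -> h z0 k <= g' k.
Hypothesis hG : G * h z0 L <= g' L.
Hypothesis L0 : (0 < L)%N.
Hypothesis k0 : 0 <= kappa.
Hypothesis loopsG : forall M, loops kappa M z0 y z0 <= G.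

Let h' z := if z == z0 then g' else h z.

Let h'0 z k : 0 <= h' z k.
Proof. by rewrite /h'; case: eqP => // _; case: (hc z). Qed.

Let h'1 z : h' z 0%N = 1.
Proof. by rewrite /h'; case: eqP => // _; case: (hc z). Qed.

Let w'0 l : 0 <= weight h' l.
Proof. by apply: prodr_ge0 => z _; apply: h'0. Qed.

Let G1 : 1 <= G.
Proof.
apply: le_trans (loopsG 1); rewrite /loops big_ord1 /= eqxx /= expr0 mulr1.
by rewrite lexx.
Qed.

Let Gge0 : 0 <= G.
Proof. exact: le_trans ler01 G1. Qed.

(** The word [a ++ c] is cut at its visit number [L] to [z0], which is also its
    last. *)
Let canon a c := (dest x a == z0) && (count_mem z0 (trace x a) == L.-1)
  && (count_mem z0 (trace z0 c) == 1%N).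

Let rest a c : R := (canon a c)%:R * (first_hit x y (a ++ c))%:R
  * (kappa ^+ size (a ++ c) * weight h' (trace x (a ++ c))) / G.

Let loop b : R := ((dest z0 b == z0) && (y \notin trace z0 b))%:R * kappa ^+ size b.

Let W s : R := (first_hit x y s)%:R * (kappa ^+ size s * weight h (trace x s)).
Let W' s : R := (first_hit x y s)%:R * (kappa ^+ size s * weight h' (trace x s)).

Let rest_ge0 a c : 0 <= rest a c.
Proof.
by rewrite /rest !mulr_ge0 ?exprn_ge0 ?w'0 ?invr_ge0 ?Gge0.
Qed.

Let loop_ge0 b : 0 <= loop b.
Proof. by rewrite mulr_ge0 ?exprn_ge0. Qed.

Let W'_ge0 s : 0 <= W' s.
Proof. by rewrite !mulr_ge0 ?exprn_ge0 ?w'0. Qed.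

Let weight_few s : (count_mem z0 (trace x s) < L)%N ->
  weight h (trace x s) <= weight h' (trace x s).
Proof.
move=> cL; apply: ler_prod => z _; rewrite /h'; case: eqP => [->|_].
  by rewrite hg' // andbT; case: (hc z0).
by rewrite lexx andbT; case: (hc z).
Qed.

Let weight_many a b c : dest x a = z0 -> count_mem z0 (trace x a) = L.-1 ->
  dest z0 b = z0 -> count_mem z0 (trace z0 c) = 1%N ->
  weight h (trace x (a ++ b ++ c)) <= weight h' (trace x (a ++ c)) / G.
Proof.
move=> da ca db cc.
have G0 : 0 < G by exact: lt_le_trans ltr01 G1.
pose l := trace x (a ++ b ++ c); pose l' := trace x (a ++ c).
have lE : l = trace x a ++ trace z0 b ++ trace z0 c.
  by rewrite /l !trace_cat da db.
have l'E : l' = trace x a ++ trace z0 c by rewrite /l' trace_cat da.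
have cl' : count_mem z0 l' = L by rewrite l'E count_cat ca cc; lia.
have le_c z : (count_mem z l' <= count_mem z l)%N.
  by rewrite lE l'E !count_cat leq_add2l leq_addl.
have h1 z : h z 0%N = 1 by case: (hc z).
have z0l : z0 \in undup l.
  by rewrite mem_undup -has_pred1 has_count (leq_trans _ (le_c z0)) // cl'.
have sl : {subset l <= undup l} by move=> z; rewrite mem_undup.
have sl' : {subset l' <= undup l}.
  move=> z; rewrite mem_undup -!has_pred1 !has_count => /leq_trans; apply.
  exact: le_c.
rewrite ler_pdivlMr // mulrC -/l -/l'.
rewrite (weightE h1 (undup_uniq l) sl) (weightE h'1 (undup_uniq l) sl').
rewrite !(bigD1_seq z0) ?undup_uniq //= mulrA; apply: ler_pM.
- by rewrite mulr_ge0 ?Gge0 //; case: (hc z0).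
- by apply: prodr_ge0 => z _; case: (hc z).
- rewrite /h' eqxx cl'; apply: le_trans hG; rewrite ler_wpM2l ?Gge0 //.
  by case: (hc z0) => _ _; apply; rewrite -cl'.
- apply: ler_prod => z /negbTE zz0; rewrite /h' zz0.
  by case: (hc z) => _ -> /= ->.
Qed.

(** Few visits are compared directly; a word with many visits is charged to the
    factorisation that isolates its loop. *)
Let split_le s : W s <= (count_mem z0 (trace x s) < L)%N%:R * W' s +
  \sum_(i < (size s).+1) \sum_(j < (size s - i).+1)
    loop (take j (drop i s)) * rest (take i s) (drop j (drop i s)).
Proof.
case: ltnP => cL.
  rewrite mul1r ler_wpDr //.
    by do 2!(apply: sumr_ge0 => ? _); rewrite mulr_ge0.
  by rewrite ler_wpM2l ?ler0n // ler_wpM2l ?exprn_ge0 // weight_few.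
rewrite mul0r add0r.
have [|a [b [c [sE da ca db cc]]]] := @loop_split z0 s x L; first by rewrite L0.
have ia : (size a < (size s).+1)%N by rewrite sE size_cat ltnS leq_addr.
have jb : (size b < (size s - Ordinal ia).+1)%N.
  by rewrite /= sE !size_cat addKn ltnS leq_addr.
rewrite (bigD1 (Ordinal ia)) //= (bigD1 (Ordinal jb)) //= -addrA ler_wpDr //.
  by rewrite addr_ge0 //; repeat (apply: sumr_ge0 => ? _); rewrite mulr_ge0.
have -> : take (size a) s = a by rewrite sE take_size_cat.
have -> : drop (size a) s = b ++ c by rewrite sE drop_size_cat.
rewrite take_size_cat // drop_size_cat //.
rewrite /W /loop /rest /canon da ca cc db !eqxx /= mul1r.
have [fh|_] := boolP (first_hit x y s); last first.
  by rewrite mul0r !mulr_ge0 ?exprn_ge0 ?w'0 ?invr_ge0 ?Gge0.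
have [fac yb] : first_hit x y (a ++ c) /\ y \notin trace z0 b.
  move: fh; rewrite /first_hit sE !dest_cat !trace_cat da db !mem_cat !negb_or.
  by move=> /and4P[-> -> -> ->].
rewrite fac yb !mul1r -mulrA mulrA -exprD.
have -> : (size b + size (a ++ c) = size s)%N.
  by rewrite sE !size_cat addnCA addnA.
by rewrite ler_wpM2l ?exprn_ge0 // sE weight_many.
Qed.

(** A word is cut at one place only, so that reassembling the two parts of a cut
    does not count it twice. *)
Let canon_uniq s : \sum_(i < (size s).+1) rest (take i s) (drop i s) <=
  (count_mem z0 (trace x s) == L)%:R * W' s / G.
Proof.
pose P (i : 'I_(size s).+1) := canon (take i s) (drop i s).
have cs i : P i -> count_mem z0 (trace x s) = L.
  rewrite /P /canon => /andP[/andP[/eqP di /eqP ci] /eqP ei].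
  by rewrite -(cat_take_drop i s) trace_cat count_cat di ci ei; lia.
have Plt i j : P i -> P j -> ~~ (i < j)%N.
  rewrite /P /canon => /andP[/andP[/eqP di /eqP ci] _] /andP[/andP[_ /eqP cj] _].
  apply/negP => ij.
  have : (L.-1 < count_mem z0 (trace x (take j s)))%N.
    have -> : take j s = take i s ++ take (j - i) (drop i s).
      by rewrite -[in RHS](take_takel s (ltnW ij)) take_drop subnK ?(ltnW ij) // cat_take_drop.
    rewrite trace_cat count_cat ci di -[X in (X < _)%N]addn0 ltn_add2l.
    case E : (take _ _) => [|u t] /=; last by rewrite eqxx.
    have := congr1 size E; rewrite size_take size_drop /=.
    by have := ltn_ord j; case: ifP; lia.
  by rewrite cj ltnn.
have Puniq i j : P i -> P j -> i = j.
  move=> Pi Pj; apply: val_inj => /=.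
  by have := Plt _ _ Pi Pj; have := Plt _ _ Pj Pi; lia.
under eq_bigr do rewrite /rest cat_take_drop -[canon _ _]/(P _) -!mulrA.
rewrite -mulr_suml -[X in _ <= X]mulrA -/(P _) !mulrA.
rewrite -[_ / G]mulrA -!mulrA; apply: ler_wpM2r.
  by rewrite !mulr_ge0 ?exprn_ge0 ?w'0 ?invr_ge0 ?Gge0.
have [i Pi|P0] := pickP P; last by rewrite big1 // => i _; rewrite P0.
rewrite (bigD1 i) //= Pi (cs i Pi) eqxx big1 ?addr0 // => j ji.
by case: (boolP (P j)) => // Pj; rewrite (Puniq _ _ Pi Pj) eqxx in ji.
Qed.

(** From a path with at least [L] visits to [z0] the loop between the visit number
    [L] and the last one is cut out.  Other sites are visited less often
    afterwards, so that their factors can only grow, and [z0] is visited exactly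
    [L] times.  The total mass of the loops that may have been there is at most
    [G], and [hG] says that passing from [h z0 L] to [g' L] makes up for it. *)
Lemma excise_site :
  passage N x y (fun s => kappa ^+ size s * weight h (trace x s)) <=
  passage N x y (fun s => kappa ^+ size s * weight h' (trace x s)).
Proof.
have G0 : 0 < G by exact: lt_le_trans ltr01 G1.
pose B j := avg j loop; pose C i k := avg i (fun a => avg k (rest a)).
have B0 j : 0 <= B j by exact: avg_ge0.
have C0 i k : 0 <= C i k by apply: avg_ge0 => a _; exact: avg_ge0.
pose few s := (count_mem z0 (trace x s) < L)%N.
have E1 : passage N x y (fun s => kappa ^+ size s * weight h (trace x s)) <=
    \sum_(n < N) avg n (fun s => (few s)%:R * W' s) +
    \sum_(n < N) \sum_(i < n.+1) \sum_(j < (n - i).+1) B j * C i (n - i - j)%N.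
  rewrite -big_split /=; apply: ler_sum => n _.
  have -> : \sum_(i < n.+1) \sum_(j < (n - i).+1) B j * C i (n - i - j)%N =
     avg n (fun s => \sum_(i < n.+1) \sum_(j < (n - i).+1)
       loop (take j (drop i s)) * rest (take i s) (drop j (drop i s))).
    rewrite (avg_splits n (fun i a t => \sum_(j < (n - i).+1)
       loop (take j t) * rest a (drop j t))).
    apply: eq_bigr => i _.
    under [RHS]eq_avg => a _ do
      rewrite (avg_splits (n - i) (fun j b c => loop b * rest a c)).
    rewrite avg_sum; apply: eq_bigr => j _; rewrite -/(B j).
    under [RHS]eq_avg => a _ do under eq_avg => b _ do rewrite avgZ mulrC.
    under [RHS]eq_avg => a _ do rewrite avgZ mulrC.
    by rewrite avgZ.
  rewrite -avgD; apply: ler_avg => s sn; rewrite -sn; exact: split_le.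
apply: le_trans E1 _.
have E2 : \sum_(n < N) \sum_(i < n.+1) \sum_(j < (n - i).+1) B j * C i (n - i - j)%N
    <= G * \sum_(n < N) \sum_(i < n.+1) C i (n - i)%N.
  rewrite (sum_triangle N (fun i m => \sum_(j < m.+1) B j * C i (m - j)%N)).
  rewrite (sum_triangle N C) mulr_sumr; apply: ler_sum => i _.
  rewrite (sum_triangle (N - i) (fun j k => B j * C i k)).
  apply: le_trans (_ : \sum_(j < N - i) B j * \sum_(k < N - i) C i k <= _).
    apply: ler_sum => j _; rewrite -mulr_sumr ler_wpM2l //.
    exact: (@ler_sum_widen _ _ _ (C i) (leq_subr _ _)).
  rewrite -mulr_suml ler_wpM2r ?sumr_ge0 //; exact: loopsG.
rewrite -lerBrDl; apply: (le_trans E2); rewrite mulrC -ler_pdivlMr //.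
rewrite -sumrB mulr_suml; apply: ler_sum => n _.
rewrite -(avg_splits n (fun _ a c => rest a c)).
rewrite mulrC -ler_pdivrMl ?invr_gt0 // invrK -avgZ lerBrDr -avgD.
apply: ler_avg => s sn; rewrite -sn.
apply: le_trans (_ : (count_mem z0 (trace x s) == L)%:R * W' s + (few s)%:R * W' s <= _).
  by rewrite lerD2r mulrC -ler_pdivlMr // canon_uniq.
rewrite -mulrDl /few -/(W' s) -[leRHS]mul1r ler_wpM2r //.
by case: ltngtP; rewrite ?addr0 ?add0r.
Qed.

End one_site.
End excision.

(** The sites are treated one after the other.  As [g] and [g'] both decrease in
    the number of visits, so do the intermediate families, which is what
    [excise_site] requires of the sites other than its own. *)
Lemma excise_all (R : realType) d N (x y : 'rV[int]_d) (g g' : nat -> R)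
    (kappa G : R) L : discount g -> discount g' ->
  (forall k, (k < L)%N -> g k <= g' k) -> G * g L <= g' L -> (0 < L)%N ->
  0 <= kappa -> (forall z M, z != y -> loops kappa M z y z <= G) ->
  passage N x y (fun s => kappa ^+ size s * weight (fun _ => g) (trace x s)) <=
  passage N x y (fun s => kappa ^+ size s * weight (fun _ => g') (trace x s)).
Proof.
move=> gc g'c gg' gG L0 k0 lG.
pose h (r : seq 'rV[int]_d) z := if z \in r then g' else g.
have hc r z : discount (h r z) by rewrite /h; case: ifP.
have cut r : y \notin r ->
    passage N x y (fun s => kappa ^+ size s * weight (fun _ => g) (trace x s)) <=
    passage N x y (fun s => kappa ^+ size s * weight (h r) (trace x s)).
  elim: r => [_|z r IH]; first by [].
  rewrite in_cons negb_or eq_sym => /andP[zy /IH le1]; apply: (le_trans le1).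
  have [zr|zr] := boolP (z \in r).
    rewrite le_eqVlt; apply/orP; left; apply/eqP; apply: eq_passage => s _ _.
    congr (_ * _); apply: eq_bigr => w _; rewrite /h in_cons.
    by case: eqP => // ->; rewrite zr.
  have hz : h r z = g by rewrite /h (negbTE zr).
  case: (g'c) => g'1 g'0 _.
  apply: le_trans (excise_site N x (hc r) g'0 g'1 _ _ L0 k0 (fun M => lG z M zy)) _;
    rewrite ?hz //.
  rewrite le_eqVlt; apply/orP; left; apply/eqP; apply: eq_passage => s _ _.
  congr (_ * _); apply: eq_bigr => w _; rewrite /h in_cons.
  by case: (w == z).
pose words := flatten [seq [seq val t | t : n.-tuple (step d)] | n <- iota 0 N].
pose r := [seq z <- flatten [seq trace x s | s <- words] | z != y].
apply: le_trans (cut r _) _; first by rewrite mem_filter eqxx.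
rewrite le_eqVlt; apply/orP; left; apply/eqP; apply: eq_passage => s sN fh.
congr (_ * _); rewrite /weight !big_seq; apply: eq_bigr => z.
rewrite mem_undup => zs; rewrite /h mem_filter.
have -> : z != y by apply: contraTneq zs => ->; case/andP: fh.
have -> // : z \in flatten [seq trace x s | s <- words].
apply/flatten_mapP; exists s => //; apply/flatten_mapP; exists (size s).
  by rewrite mem_iota.
by apply/mapP; exists (in_tuple s); rewrite ?mem_enum.
Qed.

(** * The annealed mass of the paths to a site *)

Section mass.
Context {R : realType} {d : nat}.
Hypothesis d0 : (0 < d)%N.
Implicit Types (x y z : 'rV[int]_d) (s t a b c : seq (step d)).
Implicit Types (f : seq (step d) -> R) (g : nat -> R).

Lemma avg_take m n f : (n <= m)%N -> avg m (fun s => f (take n s)) = avg n f.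
Proof.
move=> nm; rewrite -(subnKC nm) avg_cat; apply: eq_avg => s sn.
transitivity (avg (m - n) (fun _ : seq (step d) => f s * 1)).
  by apply: eq_avg => t _; rewrite take_size_cat ?mulr1.
by rewrite avgZ avg1 ?mulr1.
Qed.

Lemma avg_gt0 f s : (forall t, 0 <= f t) -> 0 < f s -> 0 < avg (size s) f.
Proof.
elim: s f => [//|u s IH] f f0 fs /=.
apply: mulr_gt0; first by rewrite invr_gt0 mulr_gt0 // ltr0n.
rewrite (bigD1 u) //=; apply: ltr_pwDl; first exact: IH.
by apply: sumr_ge0 => v _; apply: avg_ge0.
Qed.

Lemma first_hit_prefix x y s : dest x s = y ->
  exists2 n, (n <= size s)%N & first_hit x y (take n s).
Proof.
elim: s x => [|u s IH] x /=; first by exists 0%N => //; rewrite /first_hit /= andbT; apply/eqP.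
have [xy _|xy] := eqVneq x y.
  by exists 0%N => //; rewrite /first_hit /= andbT; apply/eqP.
move=> /IH[n ns fh]; exists n.+1 => //.
by move: fh; rewrite /first_hit /= in_cons negb_or [y == x]eq_sym xy.
Qed.

Lemma first_hit_uniq x y s i j : (i <= size s)%N -> (j <= size s)%N ->
  first_hit x y (take i s) -> first_hit x y (take j s) -> i = j.
Proof.
wlog ij : i j / (i <= j)%N => [H|].
  by case: (leqP i j) => [/H|/ltnW /H]; [apply|move=> K *; apply/esym/K].
move=> _ js /andP[/eqP di _] /andP[_ yj].
apply/eqP; rewrite eqn_leq ij /= leqNgt; apply: contra yj => {}ij.
have -> : take j s = take i s ++ take (j - i) (drop i s).
  by rewrite -[in RHS](take_takel s (ltnW ij)) take_drop subnK ?(ltnW ij) // cat_take_drop.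
rewrite trace_cat mem_cat di; apply/orP; right.
case E : (take _ _) => [|u t] /=; last by rewrite in_cons eqxx.
by have := congr1 size E; rewrite size_take size_drop /=; case: ifP; lia.
Qed.

Lemma sum_unique_le (I : finType) (P : pred I) (F : I -> R) (e : R) : 0 <= e ->
  (forall i j, P i -> P j -> i = j) -> (forall i, P i -> F i <= e) ->
  \sum_i (P i)%:R * F i <= e.
Proof.
move=> e0 Pu Fe; have [i Pi|P0] := pickP P; last first.
  by rewrite big1 // => i _; rewrite P0 mul0r.
rewrite (bigD1 i) //= Pi mul1r big1 ?addr0 ?Fe // => j ji.
case: (boolP (P j)) => [Pj|_]; last by rewrite mul0r.
by rewrite (Pu _ _ Pi Pj) eqxx in ji.
Qed.

(** First passages at different times, read off words of one common length. *)
Lemma passage_horizon N T x y f : (N <= T.+1)%N ->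
  passage N x y f =
  avg T (fun s => \sum_(n < N) (first_hit x y (take n s))%:R * f (take n s)).
Proof.
move=> NT; rewrite avg_sum; apply: eq_bigr => n _.
rewrite (avg_take (fun s => (first_hit x y s)%:R * f s)) //.
by have := ltn_ord n; lia.
Qed.

Definition path_weight (g : nat -> R) x s := weight (fun _ => g) (trace x s).

Lemma path_weight_ge0 g x s : discount g -> 0 <= path_weight g x s.
Proof. by move=> gc; apply: weight_ge0. Qed.

Lemma path_weight_le1 g x s : discount g -> path_weight g x s <= 1.
Proof. by move=> gc; apply: weight_le1. Qed.

Lemma path_weight_shift g x v s : path_weight g (x + v) s = path_weight g x s.
Proof. by rewrite /path_weight trace_shift weight_shift. Qed.

(** A path from [0] to [y] followed by a path from [y] to [y + z] visits [y + z],
    perhaps before its end.  Stopping it at the first visit lowers the local times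
    and raises the weight.  Both parts are read off one word of length [M + N],
    which contains at most one such pair. *)
Lemma passageM g y z M N : discount g ->
  (forall j k, g j * g k <= g (j + k)%N) ->
  passage M 0 y (path_weight g 0) * passage N 0 z (path_weight g 0) <=
  passage (M + N) 0 (y + z) (path_weight g 0).
Proof.
move=> gc gM; set w := path_weight g 0.
pose T := (M + N)%N.
rewrite (@passage_horizon (M + N) T) ?leqnSn //.
have -> : passage M 0 y w * passage N 0 z w =
   avg T (fun s => \sum_(i < M) (first_hit 0 y (take i s))%:R * (\sum_(j < N)
     (first_hit y (y + z) (take j (drop i s)))%:R *
       (w (take i s) * path_weight g y (take j (drop i s))))).
  rewrite [X in X * _]/passage mulr_suml avg_sum; apply: eq_bigr => i _.
  rewrite -(subnKC (_ : i <= T)%N); last by have := ltn_ord i; rewrite /T; lia.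
  rewrite avg_cat mulrC -avgZ; apply: eq_avg => a sa.
  under eq_avg => b _ do rewrite take_size_cat // drop_size_cat //.
  rewrite avgZ mulrCA; congr (_ * _).
  rewrite mulrC -(passageZ N 0 z (w a) w) -(passage_shift N 0 z y).
  rewrite add0r addrC (@passage_horizon _ (T - i)); last first.
    by have := ltn_ord i; rewrite /T; lia.
  apply: eq_avg => b _; apply: eq_bigr => j _.
  by rewrite -[y in path_weight g y]add0r path_weight_shift.
apply: ler_avg => s sT.
set e := (X in _ <= X).
have w0 t : 0 <= w t by exact: path_weight_ge0.
have e0 : 0 <= e by apply: sumr_ge0 => n _; rewrite mulr_ge0.
apply: sum_unique_le => // [i j Hi Hj|i Hi].
  by apply: val_inj; apply: first_hit_uniq Hi Hj; have := ltn_ord i; have := ltn_ord j; lia.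
apply: sum_unique_le => // [j k Hj Hk|j Hj].
  apply: val_inj; apply: first_hit_uniq Hj Hk; rewrite size_drop;
  by have := ltn_ord i; have := ltn_ord j; have := ltn_ord k; lia.
have ij : (i + j < T)%N by have := ltn_ord i; have := ltn_ord j; rewrite /T; lia.
have tE : take (i + j) s = take i s ++ take j (drop i s).
  by rewrite takeD.
have di : dest 0 (take i s) = y by case/andP: Hi => /eqP.
have dd : dest 0 (take (i + j) s) = y + z.
  by rewrite tE dest_cat di; case/andP: Hj => /eqP.
have [n] := first_hit_prefix dd.
rewrite size_take sT ij => nij; rewrite take_takel // => fh.
have nT : (n < M + N)%N by exact: leq_ltn_trans ij.
apply: le_trans (_ : w (take n s) <= _); last first.
  rewrite /e (bigD1 (Ordinal nT)) //= fh mul1r lerDl.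
  by apply: sumr_ge0 => k _; rewrite mulr_ge0.
apply: le_trans (_ : w (take (i + j) s) <= _).
  by rewrite {2}/w /path_weight tE trace_cat di; apply: weight_cat_ge.
apply: weight_anti => // v; rewrite -(take_takel s nij).
by rewrite -{2}(cat_take_drop n (take (i + j) s)) trace_cat count_cat leq_addr.
Qed.

Definition mass g y : R := limn (fun N => passage N 0 y (path_weight g 0)).

Lemma passage_mass_le1 g N x y : discount g -> passage N x y (path_weight g x) <= 1.
Proof.
move=> gc; apply: le_trans (passage_le1 N x y d0).
by apply: ler_passage => s _ _; apply: path_weight_le1.
Qed.

Lemma is_cvg_mass g y : discount g ->
  cvgn (fun N => passage N 0 y (path_weight g 0)).
Proof.
move=> gc; apply: nondecreasing_is_cvgn.
  by apply/nondecreasing_seqP => n; apply: passage_nondecreasing => // s; apply: path_weight_ge0.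
by exists 1 => _ [N _ <-]; apply: passage_mass_le1.
Qed.

Lemma passage_le_mass g N y : discount g ->
  passage N 0 y (path_weight g 0) <= mass g y.
Proof.
move=> gc; rewrite /mass.
apply: (@nondecreasing_cvgn_le _ (fun N => passage N 0 y (path_weight g 0)));
  last exact: is_cvg_mass.
by apply/nondecreasing_seqP => n; apply: passage_nondecreasing => // s; apply: path_weight_ge0.
Qed.

Lemma mass_le g y e : discount g ->
  (forall N, passage N 0 y (path_weight g 0) <= e) -> mass g y <= e.
Proof. by move=> gc ge; apply: limr_le; [exact: is_cvg_mass|exact: nearW]. Qed.

Lemma mass_le1 g y : discount g -> mass g y <= 1.
Proof. by move=> gc; apply: mass_le => // N; apply: passage_mass_le1. Qed.

Lemma massM g y z : discount g -> (forall j k, g j * g k <= g (j + k)%N) ->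
  mass g y * mass g z <= mass g (y + z).
Proof.
move=> gc gM.
pose p w N := passage N 0 w (path_weight g 0).
have cyz : p y N * p z N @[N --> \oo] --> mass g y * mass g z.
  by apply: cvgM; exact: is_cvg_mass.
rewrite -(cvg_lim (@Rhausdorff R) cyz); apply: limr_le.
  by apply/cvg_ex; exists (mass g y * mass g z).
apply: nearW => N /=; apply: (le_trans (passageM y z N N gc gM)).
exact: passage_le_mass.
Qed.

Lemma reachable y : exists s, dest 0 s = y.
Proof.
have reachD (i : 'I_d) (k : int) x : (exists s, dest 0 s = x) ->
    exists s, dest 0 s = x + k *: delta_mx 0 i.
  have nat_step (b : bool) (n : nat) : (exists s, dest 0 s = x) ->
      exists s, dest 0 s = x + (if b then - delta_mx 0 i else delta_mx 0 i) *+ n.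
    move=> [s sx]; elim: n => [|n [t tE]]; first by exists s; rewrite mulr0n addr0.
    by exists (t ++ [:: (i, b)]); rewrite dest_cat tE /= /step_vec /= mulrSr addrA.
  case: k => n H.
    have [s sE] := nat_step false n H; exists s; rewrite sE; congr (_ + _).
    by rewrite -scaler_nat natz.
  have [s sE] := nat_step true n.+1 H; exists s; rewrite sE; congr (_ + _).
  by rewrite NegzE scaleNr mulNrn -scaler_nat natz.
have : exists s, dest 0 s = \sum_(i < d) y 0 i *: delta_mx 0 i.
  elim/big_ind: _ => [|x z [s <-] [t <-]|i _]; first by exists [::].
    by exists (s ++ t); rewrite dest_cat -[X in dest X t]add0r dest_shift addrC.
  by have [|s sE] := reachD i (y 0 i) 0; [exists [::]|exists s; rewrite sE add0r].
by move=> [s sE]; exists s; rewrite sE [RHS]row_sum_delta.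
Qed.

Lemma mass_gt0 g y : discount g -> (forall k, 0 < g k) -> 0 < mass g y.
Proof.
move=> gc gp; have [s sy] := reachable y.
have [n ns fh] := first_hit_prefix sy.
apply: lt_le_trans (passage_le_mass n.+1 y gc).
rewrite /passage big_ord_recr /= ltr_wpDl //.
  by apply: sumr_ge0 => i _; apply: avg_ge0 => t _; rewrite mulr_ge0 // path_weight_ge0.
have -> : n = size (take n s) by rewrite size_takel.
apply: avg_gt0 => [t|]; first by rewrite mulr_ge0 // path_weight_ge0.
by rewrite fh mul1r; apply: prodr_gt0 => z _.
Qed.

End mass.

(** * Subadditive sequences *)

Section fekete.
Context {R : realType}.
Variable a : nat -> R.
Hypothesis a_ge0 : forall n, 0 <= a n.
Hypothesis aD : forall m n, a (m + n)%N <= a m + a n.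

Let aM q m r : a (q * m + r)%N <= q%:R * a m + a r.
Proof.
elim: q => [|q IH]; first by rewrite mul0n add0n mul0r add0r.
rewrite mulSn -addnA -natr1 mulrDl mul1r addrAC addrC.
exact: le_trans (aD _ _) (lerD (lexx _) IH).
Qed.

Let slopes := [set a m.+1 / m.+1%:R | m in [set: nat]].

Let slopes_lb : has_lbound slopes.
Proof. by exists 0 => _ [m _ <-]; rewrite divr_ge0. Qed.

Let inf_le m : (0 < m)%N -> inf slopes <= a m / m%:R.
Proof. by case: m => // m _; apply: ge_inf => //; exists m. Qed.

Lemma fekete : a n / n%:R @[n --> \oo] --> inf slopes.
Proof.
apply/cvgrPdist_lt => e e0.
have hi : has_inf slopes by split => //; exists (a 1%N / 1%:R), 0%N.
have e2 : 0 < e / 2 by rewrite divr_gt0.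
have [_ [m _ <-] me] := inf_adherent e2 hi.
pose C := \sum_(r < m.+1) a r.
near=> n.
have n0 : (0 < n)%N by near: n; exact: nbhs_infty_gt.
have n0' : 0 < n%:R :> R by rewrite ltr0n.
rewrite distrC ger0_norm ?subr_ge0 ?inf_le // ltrBlDr.
have aC : a (n %% m.+1)%N <= C.
  have rm : (n %% m.+1 < m.+1)%N by rewrite ltn_mod.
  by rewrite /C (bigD1 (Ordinal rm)) //= lerDl sumr_ge0.
have nC : C / (e / 2) < n%:R by near: n; exact: nbhs_infty_gtr.
rewrite ltr_pdivrMr // {1}(divn_eq n m.+1).
apply: le_lt_trans (aM _ _ _) _.
apply: le_lt_trans (_ : n%:R * (a m.+1 / m.+1%:R) + C < _).
  apply: lerD => //; rewrite mulrA mulrAC ler_wpM2r // ler_pdivlMr ?ltr0n //.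
  by rewrite -natrM ler_nat leq_trunc_div.
rewrite ltr_pdivrMr ?divr_gt0 // in nC.
apply: le_lt_trans (_ : n%:R * (a m.+1 / m.+1%:R) + n%:R * (e / 2) < _).
  by rewrite lerD2l ltW.
rewrite -mulrDr mulrC ltr_pM2r // [in ltRHS](splitr e) addrC -addrA ltrD2l.
by rewrite addrC.
Unshelve. all: by end_near. Qed.

Lemma is_cvg_slope : cvgn (fun n => a n / n%:R).
Proof. by apply/cvg_ex; eexists; exact: fekete. Qed.

Lemma lim_slope_le m : (0 < m)%N -> limn (fun n => a n / n%:R) <= a m / m%:R.
Proof. by move=> m0; rewrite (cvg_lim (@Rhausdorff R) fekete) inf_le. Qed.

End fekete.

(** * The Lyapunov exponent as a function of the discount *)

Section lyapunov.
Context {R : realType} {d : nat}.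
Hypothesis d0 : (0 < d)%N.
Implicit Types (x y z : 'rV[int]_d) (s t : seq (step d)) (g : nat -> R).

(** What is used of the Laplace transform at the integers of a law on the
    half-line.  By the last clause two parts of a path that meet at a site have at
    least the weight that they would have in independent potentials. *)
Definition laplace_discount (g : nat -> R) : Prop :=
  [/\ discount g, forall k, 0 < g k & forall j k, g j * g k <= g (j + k)%N].

Definition lyapunov (g : nat -> R) x : R :=
  limn (fun n => - ln (mass g (x *+ n)) / n%:R).

Lemma ln_mass_ge0 g y : laplace_discount g -> 0 <= - ln (mass g y).
Proof. by case=> gc gp _; rewrite oppr_ge0 ln_le0 // mass_le1. Qed.

Lemma ln_massD g x m n : laplace_discount g ->
  - ln (mass g (x *+ (m + n))) <= - ln (mass g (x *+ m)) - ln (mass g (x *+ n)).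
Proof.
move=> [gc gp gM]; rewrite -opprD lerN2 -lnM ?posrE ?mass_gt0 //.
by rewrite ler_ln ?posrE ?mulr_gt0 ?mass_gt0 // mulrnDr massM.
Qed.

Lemma is_cvg_lyapunov g x : laplace_discount g ->
  cvgn (fun n => - ln (mass g (x *+ n)) / n%:R).
Proof.
move=> gl; apply: (@is_cvg_slope R (fun n => - ln (mass g (x *+ n)))) => *.
  exact: ln_mass_ge0.
exact: ln_massD.
Qed.

Lemma lyapunov_le g x m : laplace_discount g -> (0 < m)%N ->
  lyapunov g x <= - ln (mass g (x *+ m)) / m%:R.
Proof.
move=> gl m0; apply: (@lim_slope_le R (fun n => - ln (mass g (x *+ n)))) => // *.
  exact: ln_mass_ge0.
exact: ln_massD.
Qed.

Lemma lyapunov_ge0 g x : laplace_discount g -> 0 <= lyapunov g x.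
Proof.
move=> gl; apply: limr_ge; first exact: is_cvg_lyapunov.
by apply: nearW => n; rewrite divr_ge0 // ln_mass_ge0.
Qed.

Lemma cvg_avg m (f_ : nat -> seq (step d) -> R) f :
  (forall s, f_ n s @[n --> \oo] --> f s) ->
  avg m (f_ n) @[n --> \oo] --> avg m f.
Proof.
elim: m f_ f => [|m IH] f_ f cf /=; first exact: cf.
apply: cvgMr; apply: cvg_big => [|u _].
  exact: add_continuous.
exact: (IH (fun n s => f_ n (u :: s))).
Qed.

Lemma cvg_passage N x y (f_ : nat -> seq (step d) -> R) f :
  (forall s, f_ n s @[n --> \oo] --> f s) ->
  passage N x y (f_ n) @[n --> \oo] --> passage N x y f.
Proof.
move=> cf; rewrite /passage; apply: cvg_big => [|m _].
  exact: add_continuous.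
apply: (@cvg_avg m (fun n s => (first_hit x y s)%:R * f_ n s)) => s.
exact: cvgMr.
Qed.

Lemma cvg_weight (h_ : nat -> 'rV[int]_d -> nat -> R) h l :
  (forall z k, h_ n z k @[n --> \oo] --> h z k) ->
  weight (h_ n) l @[n --> \oo] --> weight h l.
Proof.
move=> ch; rewrite /weight; apply: cvg_big => [|z _]; last exact: ch.
exact: mul_continuous.
Qed.

(** The exponent is an infimum, over the multiples of [x] and over the truncations
    of the sum over paths, of continuous functions of the discount. *)
Lemma lyapunov_usc x (g_ : nat -> nat -> R) g (e : R) :
  (forall n, laplace_discount (g_ n)) -> laplace_discount g ->
  (forall k, g_ n k @[n --> \oo] --> g k) -> 0 < e ->
  \forall n \near \oo, lyapunov (g_ n) x < lyapunov g x + e.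
Proof.
move=> gl_ gl cg e0.
have [m m0 mle] : exists2 m, (0 < m)%N &
    - ln (mass g (x *+ m)) / m%:R < lyapunov g x + e.
  have : \forall m \near \oo, (0 < m)%N /\
      - ln (mass g (x *+ m)) / m%:R < lyapunov g x + e.
    near=> m; split; first by near: m; exact: nbhs_infty_gt.
    near: m; apply: (cvgr_lt _ (is_cvg_lyapunov (x := x) gl)).
    by rewrite ltrDl.
  by move=> [m _ /(_ m (leqnn m))[m0 mle]]; exists m.
have m0' : 0 < m%:R :> R by rewrite ltr0n.
(* the value that the mass must exceed for the slope at [m] to be small *)
pose c := expR (- ((lyapunov g x + e) * m%:R)).
have cm : c < mass g (x *+ m).
  case: (gl) => gc gp _; rewrite -ltr_ln ?posrE ?expR_gt0 ?mass_gt0 //.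
  by rewrite expRK ltrNl -ltr_pdivrMr.
case: (gl) => gc gp _.
have [N cN] : exists N, c < passage N 0 (x *+ m) (path_weight g 0).
  have [N _ H] := cvgr_gt _ (is_cvg_mass d0 (y := x *+ m) gc) _ cm.
  by exists N; exact: (H N (leqnn N)).
have cw s : path_weight (g_ n) 0 s @[n --> \oo] --> path_weight g 0 s.
  by apply: (@cvg_weight (fun n _ => g_ n)) => _; exact: cg.
have near_c := cvgr_gt _ (cvg_passage (N := N) (x := 0) (y := x *+ m) cw) _ cN.
near=> n; case: (gl_ n) => gcn gpn _.
have cn : c < passage N 0 (x *+ m) (path_weight (g_ n) 0) by near: n; exact: near_c.
apply: le_lt_trans (lyapunov_le x (gl_ n) m0) _.
rewrite ltr_pdivrMr // ltrNl -[X in X < _]expRK ltr_ln ?posrE ?expR_gt0 ?mass_gt0 //.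
exact: lt_le_trans cn (passage_le_mass d0 N _ gcn).
Unshelve. all: by end_near. Qed.

Lemma lyapunov_ge_powR x g g' (t : R) : laplace_discount g -> laplace_discount g' ->
  (forall y, mass g' y <= mass g y `^ t) -> t * lyapunov g x <= lyapunov g' x.
Proof.
move=> gl gl' gg'; case: (gl) => gc gp _; case: (gl') => gc' gp' _.
have ct : t * (- ln (mass g (x *+ n)) / n%:R) @[n --> \oo] --> t * lyapunov g x.
  by apply: cvgMr; exact: is_cvg_lyapunov.
rewrite -(cvg_lim (@Rhausdorff R) ct); apply: ler_lim.
- by apply/cvg_ex; eexists; exact: ct.
- exact: is_cvg_lyapunov.
apply: nearW => n; rewrite mulrA ler_wpM2r ?invr_ge0 // mulrN lerN2 -ln_powR.
by rewrite ler_ln ?posrE ?powR_gt0 ?mass_gt0.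
Qed.

(** * Comparing two discounts *)

Lemma weight_scale (kappa : R) g (l : seq 'rV[int]_d) :
  weight (fun _ k => kappa ^+ k * g k) l = kappa ^+ size l * weight (fun _ => g) l.
Proof.
rewrite /weight big_split /=; congr (_ * _).
rewrite prodr_undup_exp_count big_const_seq count_predT.
by elim: (size l) => //= n ->; rewrite exprS.
Qed.

Lemma mass_le_powR g g' y (t : R) : laplace_discount g -> discount g' -> 0 < t < 1 ->
  (forall k, g' k <= g k `^ t) -> mass g' y <= mass g y `^ t.
Proof.
move=> [gc gp gM] gc' t01 gg'; apply: mass_le => // N.
apply: le_trans (_ : passage N 0 y (fun s => path_weight g 0 s `^ t) <= _).
  apply: ler_passage => s _ _; rewrite -weight_powR; last by case: gc.
  by apply: ler_weight => // z k; case: gc'.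
apply: passage_powR => // [s||]; first exact: path_weight_ge0.
  exact: mass_gt0.
exact: passage_le_mass.
Qed.

Lemma powR_discount g (t : R) : discount g -> (forall k, 0 < g k) -> 0 < t ->
  discount (fun k => g k `^ t).
Proof.
move=> [g0 g_ge0 gm] gp t0; split => [|l|k l kl]; rewrite ?g0 ?powR1 ?powR_ge0 //.
by apply: ge0_ler_powR; rewrite ?nnegrE ?g_ge0 ?gm // ltW.
Qed.

(** The same conclusion when the domination may fail beyond [L] visits.  There the
    loops are excised, which costs a factor [G] at each site with [L] visits; it is
    enough that [g'' L] be small compared with [g L `^ t].  The factor [kappa] per
    step that is split off from [g'] makes the loops summable in the plane. *)
Lemma mass_le_powR_excise g g' g'' y (t kappa G : R) L :
  laplace_discount g -> discount g' -> discount g'' -> 0 < t < 1 -> 0 <= kappa <= 1 ->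
  (0 < L)%N ->
  (forall k, g' k <= kappa ^+ k * g'' k) ->
  (forall k, (k < L)%N -> g'' k <= g k `^ t) -> G * g'' L <= g L `^ t ->
  (forall z M, z != y -> loops kappa M z y z <= G) ->
  mass g' y <= mass g y `^ t.
Proof.
move=> [gc gp gM] gc' gc'' t01 /andP[k0 k1] L0 gk gg'' gG lG.
have t0 : 0 < t by case/andP: t01.
apply: mass_le => // N.
have gtc := powR_discount gc gp t0.
apply: le_trans (_ : passage N 0 y (fun s =>
  kappa ^+ size s * weight (fun _ => g'') (trace 0 s)) <= _).
  apply: ler_passage => s _ _; rewrite -(size_trace 0 s) -weight_scale.
  by apply: ler_weight => // z k; case: gc'.
apply: (le_trans (excise_all N 0 gc'' gtc gg'' gG L0 k0 lG)).
apply: le_trans (_ : passage N 0 y (fun s => path_weight g 0 s `^ t) <= _).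
  apply: ler_passage => s _ _; rewrite weight_powR; last by case: gc.
  by rewrite ler_piMl ?powR_ge0 // exprn_ile1.
apply: passage_powR => // [s||]; first exact: path_weight_ge0.
  exact: mass_gt0.
exact: passage_le_mass.
Qed.

End lyapunov.

(** * Eventual domination *)

Section domination.
Context {R : realType} {d : nat}.
Hypothesis d0 : (0 < d)%N.
Implicit Types (x y z : 'rV[int]_d) (g : nat -> R).

Lemma ltr1_powR (a t : R) : 0 < a < 1 -> 0 < t < 1 -> a < a `^ t.
Proof.
move=> /andP[a0 a1] /andP[t0 t1]; rewrite -ltr_ln ?posrE ?powR_gt0 // ln_powR.
have : ln a < 0 by rewrite ln_lt0 // a0.
by move=> la; rewrite -subr_gt0 -{2}[ln a]mul1r -mulrBl nmulr_rgt0 // subr_lt0.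
Qed.

Lemma near_le_powR (g_ : nat -> nat -> R) g (t : R) L :
  (forall n, discount (g_ n)) -> laplace_discount g -> g 1%N < 1 ->
  (forall k, g_ n k @[n --> \oo] --> g k) -> 0 < t < 1 ->
  \forall n \near \oo, forall k, (k < L)%N -> g_ n k <= g k `^ t.
Proof.
move=> gc_ [gc gp gM] g1 cg t01; elim: L => [|L IH]; first exact: nearW.
have key : \forall n \near \oo, g_ n L <= g L `^ t.
  case: L {IH} => [|L].
    by apply: nearW => n; case: (gc_ n) => -> _ _; case: gc => -> _ _; rewrite powR1.
  have gL : g L.+1 < g L.+1 `^ t.
    apply: ltr1_powR => //; rewrite gp /=; apply: le_lt_trans g1.
    by case: gc => _ _; apply.
  have near_lt := cvgr_lt _ (cg L.+1) _ gL.
  by near=> n; apply: ltW; near: n; exact: near_lt.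
near=> n => k; rewrite ltnS leq_eqVlt => /predU1P[->|kL].
  by near: n; exact: key.
by move: k kL; near: n; exact: IH.
Unshelve. all: by end_near. Qed.

(** If [g] is bounded away from [0], it is nearly constant from some number of
    visits on, and by monotonicity the comparison at that number settles all larger
    ones.  If not, [g L] is for some [L] so small that its gap to [g L `^ t] exceeds
    the factor [G], and excision applies. *)
Lemma near_mass_le (g_ : nat -> nat -> R) g (t kappa G : R) :
  (forall n, laplace_discount (g_ n)) -> laplace_discount g -> g 1%N < 1 ->
  (forall k, g_ n k @[n --> \oo] --> g k) -> 0 < t < 1 -> 0 <= kappa <= 1 ->
  0 < G ->
  (forall n k, g_ n k <= kappa ^+ k * g_ n k `^ ((1 + t) / 2)) ->
  (forall y z M, z != y -> loops kappa M z y z <= G) ->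
  \forall n \near \oo, forall y, mass (g_ n) y <= mass g y `^ t.
Proof.
move=> gl_ gl g1 cg t01 k01 G0 gk lG.
have gc_ n : discount (g_ n) by case: (gl_ n).
case: (gl) => gc gp _; case: (gc) => g0 g_ge0 gm.
have [t0 t1] := andP t01.
have [[c c0 cg_le]|g_small] := pselect (exists2 c : R, 0 < c & forall k, c <= g k).
- have lb : has_lbound (range g) by exists c => _ [k _ <-].
  pose i := inf (range g).
  have ne : range g !=set0 by exists (g 0%N), 0%N.
  have i0 : 0 < i by apply: lt_le_trans c0 _; apply: lb_le_inf => // _ [k _ <-].
  have ig k : i <= g k by apply: ge_inf => //; exists k.
  have i1 : i < 1 by apply: le_lt_trans g1.
  have [] := @inf_adherent _ (range g) (i `^ t - i); first by rewrite subr_gt0 ltr1_powR // i0.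
    by split.
  move=> _ [L _ <-]; rewrite -/i addrC subrK => gL.
  have near_few := near_le_powR L gc_ gl g1 cg t01.
  have near_L := cvgr_lt _ (cg L) _ gL.
  near=> n => y; apply: (mass_le_powR d0) => // k.
  have [kL|Lk] := ltnP k L; first by move: k kL; near: n; exact: near_few.
  apply: le_trans (_ : g_ n L <= _); first by case: (gc_ n) => _ _; apply.
  apply: le_trans (_ : i `^ t <= _); first by apply: ltW; near: n; exact: near_L.
  by apply: ge0_ler_powR; rewrite ?nnegrE ?ig ?g_ge0 // ltW.
(* of the margins in [t < q < r < 1], that between [q] and [r] absorbs the error in
   [g_], and that between [t] and [q] absorbs the factor [G] *)
- pose r := (1 + t) / 2; pose q := (t + r) / 2.
  have r0 : 0 < r by rewrite /r; lra.
  have tq : t < q by rewrite /q /r; lra.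
  have qr : q < r by rewrite /q /r; lra.
  pose c := G^-1 `^ (q - t)^-1.
  have c0 : 0 < c by rewrite powR_gt0 // invr_gt0.
  have [L gL] : exists L, g L < c.
    apply: contrapT => noL; apply: g_small; exists c => // k.
    by rewrite leNgt; apply/negP => gk'; apply: noL; exists k.
  have [K [K0 gK]] : exists K, (0 < K)%N /\ g K < c.
    by exists L.+1; split => //; apply: le_lt_trans gL; apply: gm.
  have qr01 : 0 < q / r < 1.
    apply/andP; split; first by rewrite divr_gt0 // (lt_trans t0).
    by rewrite ltr_pdivrMr // mul1r.
  have near_few := near_le_powR K.+1 gc_ gl g1 cg qr01.
  near=> n => y.
  have few k : (k < K.+1)%N -> g_ n k `^ r <= g k `^ q.
    move=> kK; have : g_ n k <= g k `^ (q / r) by move: k kK; near: n; exact: near_few.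
    move=> le_k; apply: (@le_trans _ _ ((g k `^ (q / r)) `^ r)).
      by apply: ge0_ler_powR; rewrite ?nnegrE ?powR_ge0 ?(ltW r0) //; case: (gc_ n).
    by rewrite -powRrM divfK ?gt_eqF.
  have gpn k : 0 < g_ n k by case: (gl_ n).
  apply: (@mass_le_powR_excise _ _ d0 g (g_ n) (fun k => g_ n k `^ r) y t kappa G K) => //.
  + exact: powR_discount.
  + move=> k kK; apply: (le_trans (few k (ltnW kK))).
    apply: ger_powR; last exact: ltW.
    by rewrite gp /= -g0 gm.
  + apply: (@le_trans _ _ (G * g K `^ q)); first by rewrite ler_wpM2l ?few // ltW.
    have -> : g K `^ q = g K `^ (q - t) * g K `^ t.
      by rewrite -powRD ?subrK // (gt_eqF (gp K)) implybT.
    rewrite mulrA ler_piMl ?powR_ge0 // -(mulfV (lt0r_neq0 G0)).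
    rewrite ler_pM2l //.
    have -> : G^-1 = c `^ (q - t).
      by rewrite /c -powRrM mulVf ?powRr1 ?invr_ge0 ?(ltW G0) // gt_eqF ?subr_gt0.
    by apply: ge0_ler_powR; rewrite ?nnegrE ?subr_ge0 ?ltW.
  + exact: lG.
Unshelve. all: by end_near. Qed.

Lemma lyapunov_cvg x (g_ : nat -> nat -> R) g :
  (forall n, laplace_discount (g_ n)) -> laplace_discount g ->
  (forall k, g_ n k @[n --> \oo] --> g k) ->
  (forall e : R, 0 < e ->
     \forall n \near \oo, lyapunov g x - e < lyapunov (g_ n) x) ->
  lyapunov (g_ n) x @[n --> \oo] --> lyapunov g x.
Proof.
move=> gl_ gl cg lsc; apply/cvgrPdist_lt => e e0.
have near_up := lyapunov_usc d0 x gl_ gl cg e0.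
have near_lo := lsc e e0.
near=> n; rewrite distrC ltr_distl; apply/andP; split.
  by near: n; exact: near_lo.
by near: n; exact: near_up.
Unshelve. all: by end_near. Qed.

Lemma lyapunov_cvg_powR x (g_ : nat -> nat -> R) g :
  (forall n, laplace_discount (g_ n)) -> laplace_discount g ->
  (forall k, g_ n k @[n --> \oo] --> g k) ->
  (forall t : R, 0 < t < 1 ->
     \forall n \near \oo, forall y, mass (g_ n) y <= mass g y `^ t) ->
  lyapunov (g_ n) x @[n --> \oo] --> lyapunov g x.
Proof.
move=> gl_ gl cg dom; apply: lyapunov_cvg => // e e0.
have b0 := lyapunov_ge0 d0 x gl; set b := lyapunov g x in b0 *.
(* chosen so that [t * b > b - e], also when [b = 0] *)
pose t := 1 - e / (b + e + e).
have be : 0 < b + e + e by lra.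
have t01 : 0 < t < 1.
  rewrite /t subr_gt0 gtrBl divr_gt0 // ltr_pdivrMr // mul1r andbT.
  by lra.
have near_dom := dom t t01.
near=> n; apply: lt_le_trans (_ : t * b <= _).
  rewrite /t mulrBl mul1r ltrD2l ltrN2 -mulrA gtr_pMr //.
  by rewrite mulrC ltr_pdivrMr // mul1r; lra.
by apply: (lyapunov_ge_powR d0) => //; near: n; exact: near_dom.
Unshelve. all: by end_near. Qed.

(** * Green functions *)

Lemma loops_killed (kappa G : R) z y M : 0 <= kappa -> z != y ->
  1 + kappa * G <= G -> 0 <= G -> loops kappa M z y z <= G.
Proof.
move=> k0 zy kG G0.
apply: (loops_le_superharmonic (f := fun _ => G)) => // w _.
have <- : avg 1 (fun _ : seq (step d) => G) =
    (2 * d%:R)^-1 * \sum_(u : step d) G by [].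
have -> : avg 1 (fun _ : seq (step d) => G) = G * avg 1 (fun _ : seq (step d) => 1).
  by rewrite -avgZ; apply: eq_avg => s _; rewrite mulr1.
rewrite avg1 // mulr1; apply: le_trans kG; rewrite lerD2r.
by case: (w == z).
Qed.

End domination.

Section transience.
Context {R : realType}.

(** A bound of second order in [b ^+ 2], exact to first order.  Squaring, for the
    product of the two terms and for their sum, leaves polynomial inequalities. *)
Lemma invsqrt_pair_unit (b : R) : 13 * b ^+ 2 <= 1 ->
  (Num.sqrt (1 + b))^-1 + (Num.sqrt (1 - b))^-1 <=
  2 * (1 + 3 / 8 * b ^+ 2 + b ^+ 2 ^+ 2).
Proof.
move=> b1; set w := b ^+ 2 in b1 *.
have w0 : 0 <= w by exact: sqr_ge0.
have bl : -1 < b by rewrite /w in b1; nra.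
have bu : b < 1 by rewrite /w in b1; nra.
have p1 : 0 < 1 + b by lra.
have p2 : 0 < 1 - b by lra.
set u := (Num.sqrt (1 + b))^-1; set v := (Num.sqrt (1 - b))^-1.
have u0 : 0 < u by rewrite invr_gt0 sqrtr_gt0.
have v0 : 0 < v by rewrite invr_gt0 sqrtr_gt0.
have u2 : u ^+ 2 * (1 + b) = 1.
  by rewrite /u exprVn sqr_sqrtr ?ltW // mulVf // gt_eqF.
have v2 : v ^+ 2 * (1 - b) = 1.
  by rewrite /v exprVn sqr_sqrtr ?ltW // mulVf // gt_eqF.
have uv0 : 0 < u * v by exact: mulr_gt0.
have uv2 : (u * v) ^+ 2 * (1 - w) = 1.
  have -> : (u * v) ^+ 2 * (1 - w) = (u ^+ 2 * (1 + b)) * (v ^+ 2 * (1 - b)).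
    by rewrite /w; ring.
  by rewrite u2 v2 mulr1.
have uv_le : u * v <= 1 + w / 2 + w ^+ 2.
  rewrite -ler_sqr ?nnegrE ?(ltW uv0) //; last by nra.
  rewrite -(@ler_pM2r _ (1 - w)); last by lra.
  have -> : (1 + w / 2 + w ^+ 2) ^+ 2 * (1 - w) =
      1 + w ^+ 2 * (5 / 4 * (1 - w) - w ^+ 3) by field.
  rewrite uv2 lerDl mulr_ge0 ?sqr_ge0 //.
  have : w ^+ 2 * w <= 1 * w.
    by rewrite ler_wpM2r // exprn_ile1 //; lra.
  by rewrite -exprSr; lra.
have sq : u ^+ 2 + v ^+ 2 <= 2 + 2 * w + 4 * w ^+ 2.
  rewrite -(@ler_pM2r _ (1 - w)); last by lra.
  have -> : (u ^+ 2 + v ^+ 2) * (1 - w) =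
      (u ^+ 2 * (1 + b)) * (1 - b) + (v ^+ 2 * (1 - b)) * (1 + b).
    by rewrite /w; ring.
  by rewrite u2 v2; nra.
rewrite -ler_sqr ?nnegrE; [|by lra|by nra].
have -> : (u + v) ^+ 2 = (u ^+ 2 + v ^+ 2) + 2 * (u * v) by ring.
nra.
Qed.

Lemma invsqrt_pair (a b : R) : 0 < a -> 13 * b ^+ 2 <= a ^+ 2 ->
  (Num.sqrt (a + b))^-1 + (Num.sqrt (a - b))^-1 <=
  (Num.sqrt a)^-1 * (2 * (1 + 3 / 8 * (b / a) ^+ 2 + (b / a) ^+ 2 ^+ 2)).
Proof.
move=> a0 ba.
have a1 : a != 0 by rewrite gt_eqF.
have -> : a + b = a * (1 + b / a) by field.
have -> : a - b = a * (1 - b / a) by field.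
rewrite !(sqrtrM _ (ltW a0)) !invfM -[leLHS]mulrDr ler_wpM2l ?invr_ge0 ?sqrtr_ge0 //.
apply: invsqrt_pair_unit.
by rewrite expr_div_n mulrA ler_pdivrMr ?exprn_gt0 // mul1r.
Qed.

(** The Newton potential of three-dimensional space, smoothed at the origin. *)
Definition newton (x y z : R) : R :=
  (Num.sqrt (x ^+ 2 + y ^+ 2 + z ^+ 2 + 12))^-1.

(** The Newton potential is harmonic, so that in the discrete Laplacian only terms
    of order [|x|^-5] are left; among these the shift by [12] wins over the lattice
    corrections. *)
Lemma newton_superharmonic (x1 x2 x3 : R) :
  newton (x1 + 1) x2 x3 + newton (x1 - 1) x2 x3 +
  (newton x1 (x2 + 1) x3 + newton x1 (x2 - 1) x3) +
  (newton x1 x2 (x3 + 1) + newton x1 x2 (x3 - 1)) <= 6 * newton x1 x2 x3.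
Proof.
pose q := x1 ^+ 2 + x2 ^+ 2 + x3 ^+ 2; pose s := q + 12; pose a := s + 1.
have q1 : 0 <= x1 ^+ 2 by exact: sqr_ge0.
have q2 : 0 <= x2 ^+ 2 by exact: sqr_ge0.
have q3 : 0 <= x3 ^+ 2 by exact: sqr_ge0.
have q0 : 0 <= q by rewrite /q; lra.
have s0 : 0 < s by rewrite /s; lra.
have a0 : 0 < a by rewrite /a; lra.
have pair x : x ^+ 2 <= q ->
    (Num.sqrt (a + 2 * x))^-1 + (Num.sqrt (a - 2 * x))^-1 <=
    (Num.sqrt a)^-1 * (2 * (1 + 3 / 8 * (2 * x / a) ^+ 2 + (2 * x / a) ^+ 2 ^+ 2)).
  move=> xq; apply: invsqrt_pair => //.
  have -> : (2 * x) ^+ 2 = 4 * x ^+ 2 by ring.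
  have -> : a ^+ 2 = (q - 13) ^+ 2 + 52 * q by rewrite /a /s; ring.
  by have := sqr_ge0 (q - 13); lra.
have P1 := pair x1 (_ : _ <= q); have P2 := pair x2 (_ : _ <= q).
have P3 := pair x3 (_ : _ <= q).
have {}P1 := P1 ltac:(rewrite /q; lra).
have {}P2 := P2 ltac:(rewrite /q; lra).
have {}P3 := P3 ltac:(rewrite /q; lra).
rewrite /newton.
have -> : (x1 + 1) ^+ 2 + x2 ^+ 2 + x3 ^+ 2 + 12 = a + 2 * x1 by rewrite /a /s /q; ring.
have -> : (x1 - 1) ^+ 2 + x2 ^+ 2 + x3 ^+ 2 + 12 = a - 2 * x1 by rewrite /a /s /q; ring.
have -> : x1 ^+ 2 + (x2 + 1) ^+ 2 + x3 ^+ 2 + 12 = a + 2 * x2 by rewrite /a /s /q; ring.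
have -> : x1 ^+ 2 + (x2 - 1) ^+ 2 + x3 ^+ 2 + 12 = a - 2 * x2 by rewrite /a /s /q; ring.
have -> : x1 ^+ 2 + x2 ^+ 2 + (x3 + 1) ^+ 2 + 12 = a + 2 * x3 by rewrite /a /s /q; ring.
have -> : x1 ^+ 2 + x2 ^+ 2 + (x3 - 1) ^+ 2 + 12 = a - 2 * x3 by rewrite /a /s /q; ring.
rewrite -/q -/s.
pose w1 := (2 * x1 / a) ^+ 2; pose w2 := (2 * x2 / a) ^+ 2; pose w3 := (2 * x3 / a) ^+ 2.
apply: le_trans (_ : (Num.sqrt a)^-1 *
   (6 + 3 / 4 * (w1 + w2 + w3) + 2 * (w1 + w2 + w3) ^+ 2) <= _).
  have w10 : 0 <= w1 by exact: sqr_ge0.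
  have w20 : 0 <= w2 by exact: sqr_ge0.
  have w30 : 0 <= w3 by exact: sqr_ge0.
  apply: (le_trans (lerD (lerD P1 P2) P3)).
  rewrite -/w1 -/w2 -/w3 -!mulrDr ler_wpM2l ?invr_ge0 ?sqrtr_ge0 //.
  by nra.
have -> : w1 + w2 + w3 = 4 * q / a ^+ 2.
  by rewrite /w1 /w2 /w3 /q; field; rewrite gt_eqF.
pose e := s^-1.
have e0 : 0 < e by rewrite invr_gt0.
have es : e * s = 1 by rewrite mulVf // gt_eqF.
have qa : q / a ^+ 2 <= e - 12 * e ^+ 2.
  have -> : e - 12 * e ^+ 2 = q / s ^+ 2.
    by rewrite /e /s; field; rewrite gt_eqF.
  rewrite ler_wpM2l // lef_pV2 ?posrE ?exprn_gt0 //.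
  by rewrite ler_sqr ?nnegrE ?(ltW s0) ?(ltW a0) // /a; lra.
have qa0 : 0 <= q / a ^+ 2 by rewrite divr_ge0 ?sqr_ge0.
have sa : (Num.sqrt a)^-1 * (1 + e / 2 - e ^+ 2 / 8) <= (Num.sqrt s)^-1.
  have -> : a = s * (1 + e) by rewrite mulrDr mulr1 [s * e]mulrC es.
  rewrite (sqrtrM _ (ltW s0)) invfM -mulrA ler_piMr ?invr_ge0 ?sqrtr_ge0 //.
  rewrite mulrC ler_pdivrMr ?mul1r ?sqrtr_gt0; last by lra.
  have le1 : e <= 1.
    by rewrite /e invf_le1 //; rewrite /s; lra.
  rewrite -ler_sqr ?nnegrE ?sqrtr_ge0; [|by nra|by []].
  rewrite sqr_sqrtr; last by lra.
  by nra.
apply: (@le_trans _ _ (6 * ((Num.sqrt a)^-1 * (1 + e / 2 - e ^+ 2 / 8)))).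
  rewrite [leRHS]mulrCA ler_wpM2l ?invr_ge0 ?sqrtr_ge0 //.
  set p := q / a ^+ 2 in qa qa0.
  have -> : 4 * q / a ^+ 2 = 4 * p by rewrite /p; ring.
  have pe : p <= e by nra.
  by nra.
by rewrite ler_pM2l.
Qed.

(** At the origin the inequality is strict: this is the discrete Laplacian there,
    up to sign and normalisation. *)
Lemma invsqrt_superharmonic0 :
  0 < 6 * (Num.sqrt (12 : R))^-1 - 6 * (Num.sqrt (13 : R))^-1.
Proof.
rewrite subr_gt0 ltr_pM2l // ltf_pV2 ?posrE ?sqrtr_gt0 //.
by rewrite ltr_sqrt // ltr_nat.
Qed.

End transience.

Lemma sum_steps (R : realType) d (F : step d -> R) :
  \sum_(u : step d) F u = \sum_(i < d) (F (i, false) + F (i, true)).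
Proof.
transitivity (\sum_(i < d) \sum_(b : bool) F (i, b)).
  by rewrite pair_bigA; apply: eq_bigr => -[].
by apply: eq_bigr => i _; rewrite big_bool addrC.
Qed.

(** Three coordinates are enough: a step in another direction does not change
    [newton], and so it does not affect superharmonicity. *)
Lemma loops_transient (R : realType) d : exists2 G : R, 0 < G &
  forall (y z : 'rV[int]_d.+3) M, z != y -> loops 1 M z y z <= G.
Proof.
pose p0 : 'I_d.+3 := ord0; pose p1 : 'I_d.+3 := lift ord0 ord0.
pose p2 : 'I_d.+3 := lift ord0 (lift ord0 ord0).
pose N (x : 'rV[int]_d.+3) : R := newton (x 0 p0)%:~R (x 0 p1)%:~R (x 0 p2)%:~R.
have N0 : N 0 = (Num.sqrt 12)^-1.
  by rewrite /N /newton !mxE expr0n /= !add0r.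
have N_gt0 x : 0 < N x.
  by rewrite invr_gt0 sqrtr_gt0 ltr_wpDl // !addr_ge0 // sqr_ge0.
pose eta : R := 6 * (Num.sqrt 12)^-1 - 6 * (Num.sqrt 13)^-1.
have eta0 : 0 < eta by exact: invsqrt_superharmonic0.
(* normalises the defect at the origin to [1] *)
pose A : R := 2 * d.+3%:R / eta.
have A0 : 0 < A by rewrite divr_gt0 // mulr_gt0 // ltr0n.
exists (A * N 0); first by rewrite mulr_gt0.
move=> y z M zy.
rewrite -(subrr z).
apply: (loops_le_superharmonic (f := fun x => A * N (x - z))) => //.
  by move=> x; rewrite mulr_ge0 ?ltW.
move=> x _; rewrite mul1r -mulr_sumr mulrCA.
set v := x - z.
have -> : (x == z) = (v == 0) by rewrite subr_eq0.
under eq_bigr do rewrite addrAC -/v.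
have c_eq i j : (delta_mx 0 i : 'rV[int]_d.+3) 0 j = (j == i)%:R.
  by rewrite mxE.
pose S := newton ((v 0 p0)%:~R + 1) (v 0 p1)%:~R (v 0 p2)%:~R +
   newton ((v 0 p0)%:~R - 1) (v 0 p1)%:~R (v 0 p2)%:~R +
   (newton (v 0 p0)%:~R ((v 0 p1)%:~R + 1) (v 0 p2)%:~R +
   newton (v 0 p0)%:~R ((v 0 p1)%:~R - 1) (v 0 p2)%:~R) +
   (newton (v 0 p0)%:~R (v 0 p1)%:~R ((v 0 p2)%:~R + 1) +
   newton (v 0 p0)%:~R (v 0 p1)%:~R ((v 0 p2)%:~R - 1)) : R.
have sE : \sum_(u : step d.+3) N (v + step_vec u) = S + 2 * d%:R * N v.
  have Nd i : N (v + delta_mx 0 i) + N (v - delta_mx 0 i) =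
     newton ((v 0 p0)%:~R + (p0 == i)%:R) ((v 0 p1)%:~R + (p1 == i)%:R) ((v 0 p2)%:~R + (p2 == i)%:R) +
     newton ((v 0 p0)%:~R - (p0 == i)%:R) ((v 0 p1)%:~R - (p1 == i)%:R) ((v 0 p2)%:~R - (p2 == i)%:R).
    have mE (a b : 'rV[int]_d.+3) j : (a + b) 0 j = a 0 j + b 0 j by rewrite mxE.
    have nE (a : 'rV[int]_d.+3) j : (- a) 0 j = - a 0 j by rewrite mxE.
    by rewrite /N !mE !nE !c_eq !intrD !intrN !mulrz_nat.
  rewrite sum_steps.
  under eq_bigr do rewrite Nd.
  have pE : ((p0 == p1) = false) * ((p1 == p0) = false) * ((p0 == p2) = false) *
    ((p2 == p0) = false) * ((p1 == p2) = false) * ((p2 == p1) = false) by [].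
  rewrite !big_ord_recl -/p0 -/p1 -/p2 !eqxx !pE !mulr0n !mulr1n !addr0 !subr0.
  rewrite /S -!addrA; do 6! congr (_ + _).
  by rewrite -/(N v) sumr_const card_ord -mulr_natl; ring.
have key : (v == 0)%:R * eta <= 6 * N v - S.
  have [v0|_] := eqVneq v 0; last by rewrite mul0r subr_ge0 newton_superharmonic.
  rewrite mul1r /eta v0 N0 /S v0 !mxE /= /newton !add0r !expr0n /= sqrrN !expr1n.
  rewrite !addr0 !add0r.
  have -> : (1 + 12 : R) = 13 by ring.
  by rewrite le_eqVlt; apply/orP; left; apply/eqP; ring.
have D0 : 0 < 2 * d.+3%:R :> R by rewrite mulr_gt0 // ltr0n.
have DE : 2 * d.+3%:R = 6 + 2 * d%:R :> R by rewrite -addn3 natrD; ring.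
rewrite sE -lerBrDr -mulrBr.
rewrite -(ler_pM2l eta0) mulrC; apply: (le_trans key).
rewrite mulrA [eta * A]mulrC {1}/A divfK ?gt_eqF // mulrBr mulrA mulfV ?gt_eqF //.
by rewrite mul1r DE le_eqVlt; apply/orP; left; apply/eqP; ring.
Qed.

(** * The line *)

Section line.
Context {R : realType}.
(* the direction of travel, [1] or [-1]; heights increase along it *)
Variable o : int.
Hypothesis o2 : o * o = 1.
Implicit Types (x y z : 'rV[int]_1) (s t : seq (step 1)) (g : nat -> R).

Let height z : int := o * z 0 0.
Let site (c : int) : 'rV[int]_1 := const_mx (o * c).

Let oE : o = 1 \/ o = -1.
Proof.
move: o2; case: (ltgtP o 0) => [lt0|gt0| ->]; last by rewrite mulr0.
  by right; nia.
by left; nia.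
Qed.

Let heightD y z : height (y + z) = height y + height z.
Proof. by rewrite /height mxE mulrDr. Qed.

Let siteK c : height (site c) = c.
Proof. by rewrite /height mxE mulrA o2 mul1r. Qed.

Let heightK z : site (height z) = z.
Proof. by apply/rowP => i; rewrite mxE /height mulrA o2 mul1r ord1. Qed.

Let siteD b c : site (b + c) = site b + site c.
Proof. by apply/rowP => i; rewrite !mxE mulrDr. Qed.

Let height_step (u : step 1) : height (step_vec u) = if u.2 then - o else o.
Proof. by rewrite /height /step_vec; case: u.2; rewrite !mxE ord1 /= ?mulrN mulr1. Qed.

Let step_le (u : step 1) : height (step_vec u) <= 1.
Proof. by rewrite height_step; case: u.2; case: oE => ->. Qed.

(** Steps raise the height by at most one, hence a discrete intermediate value
    theorem. *)
Let climb x s (c : int) : height x <= c <= height (dest x s) ->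
  site c \in rcons (trace x s) (dest x s).
Proof.
elim: s x => [|u s IH] x /= /andP[xc cd].
  by rewrite inE -[x]heightK; apply/eqP; congr site; lia.
rewrite in_cons; have [<-|xc'] := eqVneq (height x) c; first by rewrite heightK eqxx.
rewrite IH ?orbT // cd andbT heightD.
have := step_le u; lia.
Qed.

(** With factor [1] elsewhere, disjoint strips are charged independently of each
    other. *)
Definition strip (m0 m1 : int) g z : nat -> R :=
  if m0 <= height z < m1 then g else fun _ => 1.

Lemma strip_discount m0 m1 g z : discount g -> discount (strip m0 m1 g z).
Proof. by rewrite /strip; case: ifP. Qed.

Definition strip_passage N (m : int) g : R :=
  passage N 0 (site m) (fun s => weight (strip 0 m g) (trace 0 s)).

Lemma passage_le_strip N m g : discount g ->
  passage N 0 (site m) (path_weight g 0) <= strip_passage N m g.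
Proof.
move=> gc; apply: ler_passage => s _ _; apply: ler_weight => [z k|z k _].
  by case: gc.
by rewrite /strip; case: ifP => // _; apply: discount_le1.
Qed.

Lemma strip_split g (m1 m2 : int) (l1 l2 : seq 'rV[int]_1) : discount g -> 0 <= m1 -> 0 <= m2 ->
  weight (strip 0 (m1 + m2) g) (l1 ++ l2) <=
  weight (strip 0 m1 g) l1 * weight (strip m1 (m1 + m2) g) l2.
Proof.
move=> gc m10 m20; pose r := undup (l1 ++ l2).
have sc p q z : discount (strip p q g z) by exact: strip_discount.
have s1 p q z : strip p q g z 0%N = 1 by case: (sc p q z).
have ur : uniq r by exact: undup_uniq.
have r1 : {subset l1 <= r} by move=> z zl; rewrite mem_undup mem_cat zl.
have r2 : {subset l2 <= r} by move=> z zl; rewrite mem_undup mem_cat zl orbT.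
have r3 : {subset l1 ++ l2 <= r} by move=> z; rewrite mem_undup.
rewrite (weightE (s1 _ _) ur r1) (weightE (s1 _ _) ur r2) (weightE (s1 _ _) ur r3).
rewrite -big_split /=; apply: ler_prod => z _.
case: (sc 0 (m1 + m2) z) => _ -> _ /=; rewrite count_cat.
case: gc => _ _ gm.
rewrite /strip; case: ifP => h; case: ifP => h1; case: ifP => h2;
  rewrite ?mul1r ?mulr1 ?gm ?leq_addr ?leq_addl //; exfalso; lia.
Qed.

(** The path is cut at its first visit to height [m1].  Charging only the lower
    strip before the cut and only the upper strip after it raises the weight, and
    the two parts become independent. *)
Lemma strip_passageM N g (m1 m2 : int) : discount g -> 0 <= m1 -> 0 <= m2 ->
  strip_passage N (m1 + m2) g <= strip_passage N m1 g * strip_passage N m2 g.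
Proof.
move=> gc m10 m20.
pose P s : R := (first_hit 0 (site m1) s)%:R * weight (strip 0 m1 g) (trace 0 s).
pose Q s : R := (first_hit (site m1) (site (m1 + m2)) s)%:R *
  weight (strip m1 (m1 + m2) g) (trace (site m1) s).
have w0 p q (l : seq 'rV[int]_1) : 0 <= weight (strip p q g) l.
  by apply: weight_ge0 => z; apply: strip_discount.
have P0 s : 0 <= P s by rewrite mulr_ge0.
have Q0 s : 0 <= Q s by rewrite mulr_ge0.
have -> : strip_passage N m2 g = \sum_(n < N) avg n Q.
  apply: eq_bigr => n _; apply: eq_avg => s _.
  have -> : Q s = (first_hit 0 (site m2) s)%:R *
      weight (strip m1 (m1 + m2) g) [seq z + site m1 | z <- trace 0 s].
    rewrite /Q -trace_shift add0r siteD [site m1 + _]addrC.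
    by have := first_hit_shift 0 (site m2) (site m1) s; rewrite add0r => ->.
  congr (_ * _).
  rewrite /weight undup_map_inj; last exact: addIr.
  rewrite big_map; apply: eq_bigr => z _; rewrite count_map /strip heightD siteK.
  rewrite (_ : (m1 <= _ < _) = (0 <= height z < m2)); last by lia.
  by case: ifP => // _; congr g; apply: eq_count => w /=; rewrite (inj_eq (addIr _)).
rewrite -[strip_passage N m1 g]/(\sum_(n < N) avg n P).
apply: (@le_trans _ _ (\sum_(n < N) avg n (fun s =>
    \sum_(i < n.+1) P (take i s) * Q (drop i s)))).
  apply: ler_sum => n _; apply: ler_avg => s sn.
  have [fh|_] := boolP (first_hit 0 _ s); last first.
    by rewrite mul0r sumr_ge0 // => i _; rewrite mulr_ge0.
  have [i [ile fi]] : exists i, (i <= size s)%N /\ first_hit 0 (site m1) (take i s).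
    case/andP: (fh) => /eqP ds _.
    have : site m1 \in rcons (trace 0 s) (dest 0 s).
      apply: climb; rewrite ds siteK /height mxE mulr0; lia.
    rewrite mem_rcons in_cons => /orP[/eqP E|/= v].
      have [n' n's fh'] := first_hit_prefix (esym E).
      by exists n'.
    have vc : (0 < count_mem (site m1) (trace 0 s))%N.
      by rewrite -has_count has_pred1.
    have [a [b [sE da ca]]] := visit_split vc.
    exists (size a); rewrite sE size_cat leq_addr take_size_cat //; split => //.
    by rewrite /first_hit da eqxx -has_pred1 has_count ca.
  have iN : (i < n.+1)%N by rewrite -sn ltnS.
  rewrite (bigD1 (Ordinal iN)) //= ler_wpDr //.
    by apply: sumr_ge0 => j _; rewrite mulr_ge0.
  have di : dest 0 (take i s) = site m1 by case/andP: fi => /eqP.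
  have fd : first_hit (site m1) (site (m1 + m2)) (drop i s).
    move: fh; rewrite /first_hit -{1 2}(cat_take_drop i s) dest_cat trace_cat di.
    by rewrite mem_cat negb_or => /and3P[-> _ ->].
  rewrite /P /Q fi fd !mul1r -{1}(cat_take_drop i s) trace_cat di.
  exact: strip_split.
under eq_bigr => n _.
  rewrite (avg_splits n (fun i a b => P a * Q b)).
  under eq_bigr => i _ do under eq_avg => a _ do rewrite avgZ mulrC.
  under eq_bigr => i _ do rewrite avgZ mulrC.
  over.
rewrite (sum_triangle N (fun i k => avg i P * avg k Q)) mulr_suml.
apply: ler_sum => i _; rewrite -mulr_sumr ler_wpM2l ?avg_ge0 //.
by apply: (@ler_sum_widen _ _ _ (fun k => avg k Q)); rewrite ?leq_subr // => k; apply: avg_ge0.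
Qed.

Lemma strip_passage_ge0 N m g : discount g -> 0 <= strip_passage N m g.
Proof.
move=> gc; apply: passage_ge0 => s; apply: weight_ge0 => z; exact: strip_discount.
Qed.

Lemma strip_passageX N g (m : int) j : discount g -> 0 <= m ->
  strip_passage N (m * j%:Z) g <= strip_passage N m g ^+ j.
Proof.
move=> gc m0; elim: j => [|j IH].
  rewrite mulr0 expr0; apply: le_trans (passage_le1 N 0 (site 0) (isT : (0 < 1)%N)).
  by apply: ler_passage => s _ _; apply: weight_le1 => z; apply: strip_discount.
rewrite intS mulrDr mulr1 exprS.
apply: (le_trans (strip_passageM N gc m0 _)); first by rewrite mulr_ge0.
by rewrite ler_wpM2l // strip_passage_ge0.
Qed.

(** The Green function of the walk killed at height [m] is explicit: from height
    [h] it is [2 * m] for [h <= 0], then decreases linearly to [0] at [m]. *)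
Let loops_line (m : nat) M : (0 < m)%N ->
  loops 1 M 0 (site m%:Z) (0 : 'rV[int]_1) <= (2 * m)%:R :> R.
Proof.
move=> m0.
pose phi (h : int) : int := if h <= 0 then 2 * m%:Z else
  if h < m%:Z then 2 * (m%:Z - h) else 0.
have phi0 h : 0 <= phi h by rewrite /phi; case: ifP => // _; case: ifP => //; lia.
have phiP h : h != m%:Z -> 2 * (h == 0)%:R + (phi (h + 1) + phi (h - 1)) <= 2 * phi h.
  by rewrite /phi; case: (h =P 0); do 6?case: ifP; lia.
have -> : (2 * m)%:R = (phi (height 0))%:~R :> R.
  by rewrite /height mxE mulr0 /phi lexx intrM natrM.
apply: (loops_le_superharmonic (f := fun x => (phi (height x))%:~R)) => //.
- by apply/eqP => /(congr1 height); rewrite siteK /height mxE mulr0; lia.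
- by move=> x; rewrite ler0z.
move=> x xm; rewrite mul1r sum_steps big_ord1.
rewrite !heightD !height_step /=.
have -> : (phi (height x + o))%:~R + (phi (height x - o))%:~R =
    (phi (height x + 1) + phi (height x - 1))%:~R :> R.
  by rewrite intrD; case: oE => ->; rewrite ?opprK // addrC.
have hx : height x != m%:Z by apply: contra xm => /eqP <-; rewrite heightK.
have -> : (x == 0) = (height x == 0).
  apply/eqP/eqP => [->|h0]; first by rewrite /height mxE mulr0.
  by rewrite -[x]heightK h0; apply/rowP => i; rewrite !mxE mulr0.
have := phiP _ hx; rewrite -(ler_int R) intrD !intrM mulrz_nat.
by rewrite mulr1; lra.
Qed.

(** The sites of negative height are charged in [mass] only.  A path cut at its
    last visit to the origin does not see them, and cutting it there is excision
    with [L = 1], at the expense of the Green function [2 * m]. *)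
Lemma strip_passage_le_mass N (m : nat) g : discount g -> (0 < m)%N ->
  strip_passage N m%:Z g <= (2 * m)%:R * mass g (site m%:Z).
Proof.
move=> gc m0; pose G : R := (2 * m)%:R.
have G0 : 0 <= G by exact: ler0n.
case: (gc) => g1 g_ge0 gm.
(* factor [0] for a second visit: after excision the origin is visited once *)
pose g' (k : nat) : R := if k == 0%N then 1 else if k == 1%N then G * g 1%N else 0.
have sc z : discount (strip 0 m%:Z g z) by exact: strip_discount.
have g'0 k : 0 <= g' k by rewrite /g'; do 2!case: ifP => //; rewrite mulr_ge0.
have s0 : strip 0 m%:Z g 0 = g.
  by rewrite /strip /height mxE mulr0 lexx /=; case: m m0 {G G0 g' g'0 sc}.
have hg' k : (k < 1)%N -> strip 0 m%:Z g 0 k <= g' k.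
  by case: k => // _; rewrite s0 g1.
have hG : G * strip 0 m%:Z g 0 1%N <= g' 1%N by rewrite s0 /g' eqxx.
have lG M : loops 1 M 0 (site m%:Z) 0 <= G by exact: loops_line.
have := excise_site N 0 sc g'0 (erefl : g' 0%N = 1) hg' hG (ltn0Sn 0) ler01 lG.
set h' := fun z => if z == 0 then g' else strip 0 m%:Z g z.
have drop1 F : passage N (0 : 'rV[int]_1) (site m%:Z) (fun s => 1 ^+ size s * F s) =
    passage N 0 (site m%:Z) F :> R.
  by apply: eq_passage => s _ _; rewrite expr1n mul1r.
rewrite !drop1 -/(strip_passage N m%:Z g) => /le_trans; apply.
apply: (@le_trans _ _ (G * passage N 0 (site m%:Z) (path_weight g 0))); last first.
  by rewrite ler_wpM2l // passage_le_mass.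
rewrite -passageZ; apply: ler_passage => s _ fh.
have h'0 z k : 0 <= h' z k by rewrite /h'; case: eqP => // _; case: (sc z).
case: s fh => [|u s] fh.
  case/andP: fh => /eqP /= /(congr1 height); rewrite siteK /height mxE mulr0; lia.
have z0u : 0 \in undup (trace 0 (u :: s)) by rewrite mem_undup in_cons eqxx.
have cE : count_mem 0 (trace 0 (u :: s)) = (count_mem 0 (trace (0 + step_vec u) s)).+1.
  by rewrite /= eqxx.
have [L LE] : {L | L = undup (trace 0 (u :: s))} by eexists.
rewrite /path_weight /weight -LE !(bigD1_seq 0) ?LE ?undup_uniq // -LE cE.
rewrite [X in X <= _]/= [X in _ <= X]/=.
rewrite {1}/h' eqxx.
have [c0|c0] := posnP (count_mem 0 (trace (0 + step_vec u) s)); last first.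
  have -> : g' (count_mem 0 (trace (0 + step_vec u) s)).+1 = 0.
    by rewrite /g' /=; case: (count_mem _ _) c0.
  by rewrite mul0r !mulr_ge0 //; apply: prodr_ge0.
have c0' : 0 \notin trace (0 + step_vec u) s by rewrite -has_pred1 has_count c0.
rewrite c0 {1}/g' /= -!mulrA ler_wpM2l // ler_wpM2l //.
rewrite big_seq_cond [leRHS]big_seq_cond; apply: ler_prod => z /andP[zt z0].
rewrite h'0 /= {1}/h' (negbTE z0) /strip.
case: ifP => // /negP; case.
move: zt; rewrite LE mem_undup in_cons (negbTE z0) /= => zt.
have zc : (0 < count_mem z (trace (0 + step_vec u) s))%N by rewrite -has_count has_pred1.
have [a [b [sE da ca]]] := visit_split zc.
case/andP: fh => /eqP /= ds; rewrite in_cons negb_or => /andP[_ yt].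
have h0 : height 0 = 0 by rewrite /height mxE mulr0.
apply/andP; split; [rewrite leNgt|rewrite ltNge]; apply/negP => zm.
- have : site 0 \in rcons (trace z b) (dest z b).
    apply: climb; rewrite (ltW zm) /= -da -dest_cat -sE ds siteK; lia.
  have -> : site 0 = 0 by apply/rowP => i; rewrite !mxE mulr0.
  rewrite mem_rcons in_cons -da -dest_cat -sE ds => /orP[/eqP/(congr1 height)|].
    by rewrite h0 siteK; lia.
  by apply/negP; move: c0'; rewrite sE trace_cat mem_cat negb_or => /andP[].
- have : site m%:Z \in rcons (trace 0 (u :: a)) (dest 0 (u :: a)).
    by apply: climb; rewrite h0 /= da zm.
  rewrite mem_rcons in_cons /= da in_cons => /or3P[/eqP zE|/eqP E|].
  + move: yt; rewrite zE zt //.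
  + by move: (congr1 height E); rewrite siteK h0; lia.
  + by apply/negP; move: yt; rewrite sE trace_cat mem_cat negb_or => /andP[].
Qed.

End line.

(** * Lower semicontinuity on the line *)

Section line_continuity.
Context {R : realType}.
Implicit Types (g : nat -> R).

(** Weights are at most one, so that the tail of a passage sum is bounded by the
    tail of the first passage probabilities, uniformly in [n]; convergence is only
    needed for one truncation. *)
Lemma near_passage_le d (x y : 'rV[int]_d) (f_ : nat -> seq (step d) -> R) f (e c : R) :
  (0 < d)%N -> (forall n s, 0 <= f_ n s <= 1) ->
  (forall s, f_ n s @[n --> \oo] --> f s) ->
  (forall N, passage N x y f <= c) -> 0 < e ->
  \forall n \near \oo, forall N, passage N x y (f_ n) <= c + e.
Proof.
move=> d0 f01 cf fc e0.
pose P N := passage N x y (fun _ => 1 : R).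
have P_nd : nondecreasing_seq P.
  by move=> M N MN; apply: passage_nondecreasing.
have P_cvg : cvgn P.
  apply: nondecreasing_is_cvgn => //.
  by exists 1 => _ [N _ <-]; apply: passage_le1.
have P_le N : P N <= limn P by exact: nondecreasing_cvgn_le.
have e2 : 0 < e / 2 by rewrite divr_gt0.
have Pe : limn P - e / 2 < limn P by rewrite gtrBl.
have [M0 _ HM] := cvgr_gt _ P_cvg _ Pe.
have {}HM : limn P - e / 2 < P M0 by exact: (HM M0 (leqnn M0)).
have cM : c < c + e / 2 by rewrite ltrDl.
have near_M := cvgr_lt _ (cvg_passage (N := M0) (x := x) (y := y) cf) _
  (le_lt_trans (fc M0) cM).
near=> n.
have fM : passage M0 x y (f_ n) < c + e / 2 by near: n; exact: near_M.
move=> N.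
have f0 s : 0 <= f_ n s by case/andP: (f01 n s).
have [NM|/ltnW MN] := leqP N M0.
  by apply: le_trans (passage_nondecreasing x y f0 NM) _; lra.
have : passage M0 x y (fun s => 1 + -1 * f_ n s) <=
       passage N x y (fun s => 1 + -1 * f_ n s).
  by apply: passage_nondecreasing => // s; case/andP: (f01 n s); lra.
rewrite !passageD !passageZ -/(P M0) -/(P N).
by have := P_le N; lra.
Unshelve. all: by end_near. Qed.

Lemma ln_sublinear (e : R) k : 0 < e ->
  exists2 n, (0 < n)%N & ln (4 * (k * n)%:R) < e * n%:R.
Proof.
move=> e0; have [M _ HM] := @nbhs_infty_gtr R (16 * k%:R / e ^+ 2).
exists M.+1 => //.
have n0 : 0 < M.+1%:R :> R by rewrite ltr0n.
have := HM M.+1 (leqnSn M); rewrite /= ltr_pdivrMr ?exprn_gt0 // => Hn.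
case: k HM Hn => [|k] _ Hn.
  by rewrite mul0n mulr0 ln0 // mulr_gt0.
rewrite -[X in _ < X]expRK ltr_ln ?posrE ?expR_gt0 ?mulr_gt0 ?ltr0n //.
set y := e * M.+1%:R.
have y0 : 0 < y by rewrite mulr_gt0.
have -> : y = y / 2 + y / 2 by rewrite -splitr.
rewrite expRD.
have := expR_ge1Dx (y / 2); set E := expR _ => HE.
apply: (@lt_le_trans _ _ ((y / 2) * (y / 2))); last by nra.
by rewrite natrM /y; nra.
Qed.

(** By submultiplicativity it suffices to bound the strip mass at one distance [m].
    A factor [2 * m] is lost to the Green function and a factor [2] to the passage
    from [g] to [g_ n], in all less than [exp (e * n0)]. *)
Lemma lyapunov_lsc_line (x : 'rV[int]_1) (g_ : nat -> nat -> R) g (e : R) :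
  (forall n, laplace_discount (g_ n)) -> laplace_discount g ->
  (forall k, g_ n k @[n --> \oo] --> g k) -> 0 < e ->
  \forall n \near \oo, lyapunov g x - e < lyapunov (g_ n) x.
Proof.
move=> gl_ gl cg e0.
have d1 : (0 < 1)%N by [].
case: (gl) => gc gp _.
have [->|x0] := eqVneq x 0.
  apply: nearW => n; apply: lt_le_trans (lyapunov_ge0 d1 0 (gl_ n)).
  rewrite subr_lt0; apply: le_lt_trans e0.
  apply: le_trans (lyapunov_le d1 0 gl (ltn0Sn 0)) _.
  rewrite mul0rn divr1 oppr_le0 ln_ge0 //.
  apply: le_trans (passage_le_mass d1 1 0 gc).
  rewrite /passage big_ord1 /= /first_hit /= eqxx mul1r.
  by rewrite /path_weight /weight big_nil.
pose o := sgz (x 0 0); pose k := absz (x 0 0).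
have xc0 : x 0 0 != 0.
  by apply: contra x0 => /eqP x0; apply/eqP/rowP => i; rewrite ord1 x0 mxE.
have o2 : o * o = 1 by rewrite mulz_sg xc0.
have k0 : (0 < k)%N by rewrite absz_gt0.
have xE n : x *+ n = const_mx (o * (k * n)%:Z).
  apply/rowP => i; rewrite ord1 mulmxnE mxE PoszM mulrA.
  by rewrite -intEsg -mulr_natr natz.
set b := lyapunov g x.
have [n0 n0_gt ln_lt] := ln_sublinear k e0.
pose m := (k * n0)%N.
have m0 : (0 < m)%N by rewrite muln_gt0 k0.
have m0' : 0 < m%:R :> R by rewrite ltr0n.
have n0' : 0 < n0%:R :> R by rewrite ltr0n.
pose c : R := (2 * m)%:R * expR (- (b * n0%:R)).
have c0 : 0 < c by rewrite mulr_gt0 ?expR_gt0 // ltr0n muln_gt0.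
have strip_c N : strip_passage o N m%:Z g <= c.
  apply: le_trans (strip_passage_le_mass o2 N gc m0) _.
  rewrite ler_wpM2l // -xE.
  rewrite -ler_ln ?posrE ?expR_gt0 ?mass_gt0 // expRK lerNr -ler_pdivlMr //.
  exact: lyapunov_le.
have sc_ n z : discount (strip o 0 m%:Z (g_ n) z).
  by apply: strip_discount; case: (gl_ n).
have near_c : \forall n \near \oo, forall N, strip_passage o N m%:Z (g_ n) <= c + c.
  apply: (near_passage_le (f_ := fun n s => weight (strip o 0 m%:Z (g_ n)) (trace 0 s))
    (f := fun s => weight (strip o 0 m%:Z g) (trace 0 s))) => // [n s|s].
    by rewrite weight_ge0 ?weight_le1.
  apply: cvg_weight => z l; rewrite /strip; case: ifP => _; first exact: cg.
  exact: cvg_cst.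
near=> n.
have gcn : discount (g_ n) by case: (gl_ n).
have strip_cn N : strip_passage o N m%:Z (g_ n) <= c + c.
  by move: N; near: n; exact: near_c.
have mass_c j : mass (g_ n) (x *+ (n0 * j)) <= (c + c) ^+ j.
  apply: mass_le => // N; rewrite xE mulnA PoszM.
  apply: (le_trans (passage_le_strip _ _ _ gcn)).
  apply: (le_trans (strip_passageX o2 _ _ gcn _)) => //.
  by apply: lerXn2r; rewrite ?nnegrE ?strip_passage_ge0 // addr_ge0 // ltW.
have b_lt : b - e < - ln (c + c) / n0%:R.
  have -> : c + c = (4 * (k * n0)%:R) * expR (- (b * n0%:R)).
    by rewrite /c /m natrM; ring.
  rewrite lnM ?posrE ?expR_gt0 ?mulr_gt0 // expRK ltr_pdivlMr //.
  by rewrite mulrBl; lra.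
apply: (lt_le_trans b_lt); rewrite leNgt; apply/negP => lt_b.
have [M _ HM] := cvgr_lt _ (is_cvg_lyapunov d1 (x := x) (gl_ n)) _ lt_b.
have nM : (M <= n0 * M.+1)%N by rewrite (leq_trans (leqnSn M)) // leq_pmull.
have M0 : 0 < (n0 * M.+1)%:R :> R by rewrite ltr0n muln_gt0 n0_gt.
have := HM _ nM; rewrite /= ltr_pdivrMr // natrM mulrA divfK ?gt_eqF //.
rewrite mulNr ltrN2 ltNge => /negP; apply.
have cc0 : 0 < c + c by rewrite addr_gt0.
rewrite mulr_natr -lnXn // ler_ln ?posrE ?exprn_gt0 ?mass_gt0 //.
by case: (gl_ n).
Unshelve. all: by end_near. Qed.

End line_continuity.

(** * Continuity of the exponent in the discount *)

(** In two dimensions the walk is recurrent.  A small power of [g_ n k <= r ^+ k]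
    is split off as a killing rate, which makes the loops summable. *)
Theorem lyapunov_continuous (R : realType) d (x : 'rV[int]_d)
    (g_ : nat -> nat -> R) (g : nat -> R) : (0 < d)%N ->
  (forall n, laplace_discount (g_ n)) -> laplace_discount g -> g 1%N < 1 ->
  (forall k, g_ n k @[n --> \oo] --> g k) ->
  (d = 2%N -> exists2 r : R, 0 < r < 1 & forall n k, g_ n k <= r ^+ k) ->
  lyapunov (g_ n) x @[n --> \oo] --> lyapunov g x.
Proof.
move=> d0 gl_ gl g1 cg hd2.
have half (t : R) : 0 < t < 1 -> 0 < (1 + t) / 2 < 1 by move=> /andP[]; lra.
case: d d0 x hd2 => [//|[|[|d]]] d0 x hd2.
- by apply: lyapunov_cvg => // e e0; exact: lyapunov_lsc_line.
- have [//|r /andP[r0 r1] gr] := hd2.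
  apply: lyapunov_cvg_powR => // t t01.
  have [q0 q1] := andP (half t t01).
  pose kappa := r `^ (1 - (1 + t) / 2).
  have kappa0 : 0 < kappa by rewrite powR_gt0.
  have kappa1 : kappa < 1.
    by rewrite -ltr_ln ?posrE // ln1 ln_powR pmulr_rlt0 ?subr_gt0 // ln_lt0 // r0.
  apply: (@near_mass_le _ _ d0 g_ g t kappa (1 - kappa)^-1) => //.
  + by rewrite !ltW.
  + by rewrite invr_gt0 subr_gt0.
  + move=> n k; case: (gl_ n) => _ gpn _.
    rewrite [leLHS](_ : _ = g_ n k `^ (1 - (1 + t) / 2) * g_ n k `^ ((1 + t) / 2)); last first.
      by rewrite -powRD ?subrK ?powRr1 ?(gt_eqF (gpn k)) ?implybT // ltW.
    rewrite ler_wpM2r ?powR_ge0 // -(powR_mulrn _ (ltW kappa0)) /kappa powRAC.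
    rewrite (powR_mulrn _ (ltW r0)).
    by apply: ge0_ler_powR; rewrite ?nnegrE ?exprn_ge0 ?gr ?subr_ge0 // ltW.
  + have k1 : 0 < 1 - kappa by rewrite subr_gt0.
    move=> y z M zy; apply: loops_killed; rewrite ?invr_ge0 ?(ltW k1) ?(ltW kappa0) //.
    by rewrite le_eqVlt; apply/orP; left; apply/eqP; field; rewrite gt_eqF.
- apply: lyapunov_cvg_powR => // t t01.
  have [q0 q1] := andP (half t t01).
  have [G G0 lG] := loops_transient R d.
  apply: (@near_mass_le _ _ d0 g_ g t 1 G) => // [|n k]; first by rewrite ler01 lexx.
  rewrite expr1n mul1r; case: (gl_ n) => gcn gpn _.
  by apply: ger1_powR; [rewrite gpn discount_le1|rewrite ltW].
Qed.

(** * Means of bounded random variables *)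

Section mean.
Context {R : realType} {dT : measure_display} {T : measurableType dT}.
Variable P : probability T R.
Implicit Types (Y Z : T -> R) (A : set T).

Definition mean Y : R := fine 'E_P[Y].

Definition bounded_rv Y : Prop :=
  measurable_fun [set: T] Y /\ exists M : R, forall w, `|Y w| <= M.

Let integrable_rv Y : bounded_rv Y -> P.-integrable [set: T] (EFin \o Y).
Proof.
move=> [mY [M YM]]; apply: measurable_bounded_integrable => //.
  by apply: le_lt_trans (probability_le1 P measurableT) _; exact: ltry.
by exists M; split; [exact: num_real|move=> x Mx w _; exact: le_trans (YM w) (ltW Mx)].
Qed.

Let meanE Y : mean Y = (\int[P]_w Y w)%R.
Proof. by rewrite /mean unlock. Qed.

Lemma EFin_mean Y : bounded_rv Y -> (mean Y)%:E = (\int[P]_w (Y w)%:E)%E.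
Proof.
move=> bY; rewrite /mean unlock fineK //.
by apply: integrable_fin_num => //; exact: integrable_rv.
Qed.

Lemma bounded_rv_cst (a : R) : bounded_rv (fun _ => a).
Proof. by split; [exact: measurable_cst|exists `|a|]. Qed.

Lemma bounded_rvD Y Z : bounded_rv Y -> bounded_rv Z -> bounded_rv (fun w => Y w + Z w).
Proof.
move=> [mY [M YM]] [mZ [N ZN]]; split; first exact: measurable_realfun.measurable_funD.
by exists (M + N) => w; apply: le_trans (ler_normD _ _) (lerD _ _).
Qed.

Lemma bounded_rvM Y Z : bounded_rv Y -> bounded_rv Z -> bounded_rv (fun w => Y w * Z w).
Proof.
move=> [mY [M YM]] [mZ [N ZN]]; split; first exact: measurable_realfun.measurable_funM.
by exists (M * N) => w; rewrite normrM ler_pM.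
Qed.

Lemma bounded_rvZ (a : R) Y : bounded_rv Y -> bounded_rv (fun w => a * Y w).
Proof. by apply: bounded_rvM; exact: bounded_rv_cst. Qed.

Lemma bounded_rv_sum (I : Type) (r : seq I) (F : I -> T -> R) :
  (forall i, bounded_rv (F i)) -> bounded_rv (fun w => \sum_(i <- r) F i w).
Proof.
move=> bF; elim: r => [|i r IH].
  by under eq_fun do rewrite big_nil; exact: bounded_rv_cst.
by under eq_fun do rewrite big_cons; exact: bounded_rvD.
Qed.

Lemma bounded_rv_prod (I : Type) (r : seq I) (F : I -> T -> R) :
  (forall i, bounded_rv (F i)) -> bounded_rv (fun w => \prod_(i <- r) F i w).
Proof.
move=> bF; elim: r => [|i r IH].
  by under eq_fun do rewrite big_nil; exact: bounded_rv_cst.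
by under eq_fun do rewrite big_cons; exact: bounded_rvM.
Qed.

Lemma bounded_rv_indic A : measurable A -> bounded_rv (fun w => (w \in A)%:R).
Proof.
move=> mA; split; first exact: (measurable_realfun.measurable_indic mA).
by exists 1 => w; case: (w \in A); rewrite ?normr1 ?normr0.
Qed.

Lemma ler_mean Y Z : bounded_rv Y -> bounded_rv Z -> (forall w, Y w <= Z w) ->
  mean Y <= mean Z.
Proof.
move=> bY bZ YZ; rewrite !meanE; apply: le_Rintegral => //; exact: integrable_rv.
Qed.

Lemma meanD Y Z : bounded_rv Y -> bounded_rv Z ->
  mean (fun w => Y w + Z w) = mean Y + mean Z.
Proof. by move=> bY bZ; rewrite !meanE RintegralD //; exact: integrable_rv. Qed.

Lemma meanZ (a : R) Y : bounded_rv Y -> mean (fun w => a * Y w) = a * mean Y.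
Proof. by move=> bY; rewrite !meanE RintegralZl //; exact: integrable_rv. Qed.

Lemma mean_cst (a : R) : mean (fun _ => a) = a.
Proof. by rewrite /mean (expectation_cst P a). Qed.

Lemma mean_sum (I : Type) (r : seq I) (F : I -> T -> R) :
  (forall i, bounded_rv (F i)) ->
  mean (fun w => \sum_(i <- r) F i w) = \sum_(i <- r) mean (F i).
Proof.
move=> bF; elim: r => [|i r IH].
  by rewrite big_nil -[RHS](mean_cst 0); congr mean; apply/funext => w; rewrite big_nil.
rewrite big_cons -IH -meanD //; last exact: bounded_rv_sum.
by congr mean; apply/funext => w; rewrite big_cons.
Qed.

Lemma mean_indic A : measurable A -> mean (fun w => (w \in A)%:R) = fine (P A).
Proof. by move=> mA; rewrite /mean -(expectation_indic P mA). Qed.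

Lemma mean_ge0 Y : (forall w, 0 <= Y w) -> 0 <= mean Y.
Proof. by move=> Y0; apply: fine_ge0; exact: expectation_ge0. Qed.

(** Let [y] be the level at which [Y ^+ j] equals its mean.  The differences
    [Y ^+ j - y ^+ j] and [Y ^+ k - y ^+ k] have the same sign, and the mean of
    their product is the difference of the two sides. *)
Lemma mean_powM Y j k : bounded_rv Y -> (forall w, 0 < Y w <= 1) ->
  mean (fun w => Y w ^+ j) * mean (fun w => Y w ^+ k) <=
  mean (fun w => Y w ^+ (j + k)).
Proof.
move=> bY Y01.
have bX n : bounded_rv (fun w => Y w ^+ n).
  elim: n => [|n IH]; first by under eq_fun do rewrite expr0; exact: bounded_rv_cst.
  by under eq_fun do rewrite exprS; exact: bounded_rvM.
case: j => [|j].
  by under eq_fun do rewrite expr0; rewrite mean_cst mul1r.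
set a := mean (fun w => Y w ^+ j.+1).
have a0 : 0 <= a by apply: mean_ge0 => w; rewrite exprn_ge0 // ltW //; case/andP: (Y01 w).
pose y := a `^ (j.+1%:R)^-1.
have y0 : 0 <= y by exact: powR_ge0.
have yj : y ^+ j.+1 = a.
  by rewrite -powR_mulrn // /y -powRrM mulVf ?powRr1 // pnatr_eq0.
have key w : 0 <= (Y w ^+ j.+1 - y ^+ j.+1) * (Y w ^+ k - y ^+ k).
  have Y0 : 0 <= Y w by case/andP: (Y01 w) => /ltW.
  have [le|/ltW le] := leP y (Y w).
    by rewrite mulr_ge0 // subr_ge0 lerXn2r.
  by rewrite mulr_le0 // subr_le0 lerXn2r.
have : 0 <= mean (fun w => Y w ^+ (j.+1 + k) +
    (- y ^+ k * Y w ^+ j.+1 + (- a * Y w ^+ k + a * y ^+ k))).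
  apply: mean_ge0 => w; apply: le_trans (key w) _.
  by rewrite yj exprD le_eqVlt; apply/orP; left; apply/eqP; ring.
rewrite !meanD ?meanZ ?mean_cst -/a; do ?[exact: bX | exact: bounded_rv_cst |
  apply: bounded_rvD | apply: bounded_rvZ].
lra.
Qed.

End mean.

(** * Layer cake with prescribed levels *)

Lemma sum_lt_min (R : realType) N m :
  \sum_(j < N) (j < m)%N%:R = (minn N m)%:R :> R.
Proof.
elim: N => [|N IH]; first by rewrite big_ord0 min0n.
by rewrite big_ord_recr /= IH -natrD; congr _%:R; case: ltnP; lia.
Qed.

(** Any choice of one level in each of the [N] slices of [0, 1] represents [y]
    up to [1 / N]; the freedom is used to place the levels at continuity
    points. *)
Lemma layer_cake (R : realType) N (s : nat -> R) (y : R) : (0 < N)%N -> 0 <= y <= 1 ->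
  (forall j, j%:R / N%:R < s j <= j.+1%:R / N%:R) ->
  `|y - N%:R^-1 * \sum_(j < N) (s j <= y)%R%:R| <= N%:R^-1.
Proof.
move=> N0 /andP[y0 y1] sj.
have N0' : 0 < N%:R :> R by rewrite ltr0n.
pose m := Num.truncn (y * N%:R).
have yN0 : 0 <= y * N%:R by rewrite mulr_ge0.
have /andP[my ym] : m%:R <= y * N%:R < m.+1%:R by exact: truncn_itv.
have mN : (m <= N)%N.
  by rewrite -(ler_nat R); apply: le_trans my _; rewrite ler_piMl.
set S := \sum_(j < N) _.
have lo : m%:R <= S.
  rewrite -[m in leLHS](minn_idPr mN) -sum_lt_min; apply: ler_sum => j _.
  case: ltnP => [jm|//]; rewrite (_ : s j <= y) //.
  case/andP: (sj j) => _ /le_trans; apply.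
  by rewrite ler_pdivrMr //; apply: le_trans my; rewrite ler_nat.
have hi : S <= m.+1%:R.
  apply: (@le_trans _ _ (\sum_(j < N) (j < m.+1)%N%:R)); last first.
    by rewrite sum_lt_min ler_nat geq_minr.
  apply: ler_sum => j _; case: (boolP (s j <= y)) => // sy.
  rewrite (_ : (j < m.+1)%N) //.
  case/andP: (sj j) => sj1 _; have := lt_le_trans sj1 sy.
  rewrite ltr_pdivrMr // => /lt_trans /(_ ym); rewrite ltr_nat; exact.
have -> : y - N%:R^-1 * S = (y * N%:R - S) / N%:R by field; rewrite gt_eqF.
rewrite normrM [X in _ * X]ger0_norm ?invr_ge0 ?(ltW N0') // ler_piMl ?invr_ge0 //.
by rewrite ler_norml; apply/andP; split; move: lo hi; rewrite -natr1; lra.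
Qed.

(** The discontinuities are countable, and an interval is not. *)
Lemma exists_continuity_point (R : realType) (F : R -> R) (a b : R) :
  {homo F : x y / x <= y} -> a < b ->
  exists2 t, a < t < b & {for t, continuous F}.
Proof.
move=> Fnd ab; apply: contrapT => noc.
have ndF : {in `[a, b] &, nondecreasing_fun F} by move=> x y _ _; exact: Fnd.
have sub : [set` (`]a, b[)] `<=` [set x | x \in (`]a, b[) /\ discontinuity F x].
  move=> t /= tab; split => //.
  have cl : cvg (F x @[x --> t^'-]).
    apply: nondecreasing_at_left_is_cvgr; first by apply: nearW => x u v _ _; exact: Fnd.
    apply: nearW => x; exists (F t) => _ [u /= + <-]; rewrite in_itv /= => /andP[_ /ltW].
    exact: Fnd.
  have cr : cvg (F x @[x --> t^'+]).
    apply: nondecreasing_at_right_is_cvgr; first by apply: nearW => x u v _ _; exact: Fnd.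
    apply: nearW => x; exists (F t) => _ [u /= + <-]; rewrite in_itv /= => /andP[/ltW + _].
    exact: Fnd.
  split => //; apply/negP => /eqP lr; apply: noc; exists t.
    by move: tab; rewrite in_itv.
  have lF : lim (F x @[x --> t^'-]) <= F t.
    by apply: limr_le => //; near=> u; apply: Fnd; near: u; exact: nbhs_left_le.
  have Fr : F t <= lim (F x @[x --> t^'+]).
    by apply: limr_ge => //; near=> u; apply: Fnd; near: u; exact: nbhs_right_ge.
  have El : lim (F x @[x --> t^'-]) = F t.
    by apply/eqP; rewrite eq_le lF lr Fr.
  by apply/left_right_continuousP; split; [rewrite -El|rewrite -El lr].
have := countable_lebesgue_measure0 (sub_countable (subset_card_le sub)
  (discontinuity_countable ndF)).
rewrite lebesgue_measure_itv /= lte_fin ab => /eqP.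
by rewrite -EFinB eqe subr_eq0 gt_eqF.
Unshelve. all: by end_near. Qed.

(** * The discount of a potential *)

Lemma eq_of_invn (R : realType) (a b C : R) :
  (forall N, (0 < N)%N -> `|a - b| <= C * N%:R^-1) -> a = b.
Proof.
move=> H; apply/eqP; rewrite -subr_eq0 -normr_le0 leNgt; apply/negP => ab0.
have [M _ HM] := nbhs_infty_gtr (C / `|a - b|).
have := HM M.+1 (leqnSn M); rewrite /= ltr_pdivrMr // => HC.
have := H M.+1 (ltn0Sn M); rewrite -ler_pdivrMr ?invr_gt0 ?ltr0n // invrK mulrC.
by rewrite leNgt HC.
Qed.

Section laplace.
Context {R : realType}.

Definition laplace {dT} {T : measurableType dT} (P : probability T R)
  (X : {RV P >-> R}) (k : nat) : R := mean P (fun w => expR (- X w) ^+ k).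

(** One level in each slice of [0, 1].  The levels are parametrised by [t], the
    points at which the distribution function is evaluated. *)
Definition slices (k N : nat) (t : nat -> R) : Prop :=
  forall j, j%:R / N%:R < expR (- t j) ^+ k <= j.+1%:R / N%:R.

Lemma exists_slices (F : R -> R) (k N : nat) : {homo F : x y / x <= y} ->
  (0 < k)%N -> (0 < N)%N ->
  exists2 t : nat -> R, slices k N t & forall j, {for t j, continuous F}.
Proof.
move=> Fnd k0 N0.
have k0' : 0 < k%:R :> R by rewrite ltr0n.
have N0' : 0 < N%:R :> R by rewrite ltr0n.
have ex j : exists t : R, (j%:R / N%:R < expR (- t) ^+ k <= j.+1%:R / N%:R) /\
    {for t, continuous F}.
  (* the upper half of the slice, so that [b > 0] also for [j = 0] *)
  pose a : R := j.+1%:R / N%:R; pose b : R := (j%:R + 2^-1) / N%:R.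
  have a0 : 0 < a by rewrite divr_gt0 // ltr0n.
  have b0 : 0 < b by rewrite divr_gt0 // ltr_wpDl // invr_gt0.
  have ba : b < a by rewrite ltr_pM2r ?invr_gt0 // -[j.+1]addn1 natrD ltrD2l invf_lt1 ?ltr1n.
  have lnba : - ln a / k%:R < - ln b / k%:R.
    by rewrite ltr_pM2r ?invr_gt0 // ltrN2 ltr_ln.
  have [t /andP[at_ tb] ct] := exists_continuity_point Fnd lnba.
  exists t; split => //; rewrite -expRM_natl; apply/andP; split.
    apply: (@lt_trans _ _ b).
      by rewrite ltr_pM2r ?invr_gt0 // ltrDl invr_gt0.
    rewrite -[b]lnK ?posrE // ltr_expR mulrN ltrNr.
    by rewrite [ltLHS]mulrC -ltr_pdivlMr // mulNr.
  rewrite -[leRHS]lnK ?posrE // ler_expR mulrN lerNl.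
  by rewrite [leRHS]mulrC -ler_pdivrMr // ltW.
have [t ht] := choice ex.
by exists t => j; case: (ht j).
Qed.

Section one.
Context {dT : measure_display} {T : measurableType dT} {P : probability T R}.
Variable X : {RV P >-> R}.
Hypothesis X0 : forall w, 0 <= X w.

Let mX : measurable_fun [set: T] X.
Proof. exact: measurable_funPT. Qed.

Lemma expRN_01 (x : R) k : 0 <= x -> 0 <= expR (- x) ^+ k <= 1.
Proof.
move=> x0; rewrite exprn_ge0 ?expR_ge0 //= exprn_ile1 ?expR_ge0 //.
by rewrite -[leRHS]expR0 ler_expR oppr_le0.
Qed.

Lemma bounded_rv_laplace k : bounded_rv (fun w => expR (- X w) ^+ k).
Proof.
split.
  apply: measurable_realfun.measurable_funX; apply: measurableT_comp => //.
  exact: measurableT_comp.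
by exists 1 => w; case/andP: (expRN_01 k (X0 w)) => a b; rewrite ger0_norm.
Qed.

Lemma measurable_RV_le t : measurable [set w | X w <= t].
Proof.
have -> : [set w | X w <= t] = X @^-1` `]-oo, t].
  by apply/seteqP; split => w /=; rewrite in_itv.
by rewrite -[X in measurable X]setTI; apply: mX.
Qed.

Lemma cdfE t : fine (cdf X t) = mean P (fun w => (w \in [set w | X w <= t])%:R).
Proof.
rewrite mean_indic; last exact: measurable_RV_le.
by rewrite /cdf /distribution /pushforward; congr (fine (P _)).
Qed.

Lemma slices_level k N t w j : slices k N t -> (0 < k)%N ->
  (expR (- t j) ^+ k <= expR (- X w) ^+ k) = (w \in [set w | X w <= t j]).
Proof.
move=> _ k0; rewrite -!expRM_natl ler_expR !mulrN lerN2.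
by rewrite ler_pM2l ?ltr0n //; apply/idP/idP; rewrite inE.
Qed.

Lemma laplace_layer_cake k N t w : (0 < k)%N -> (0 < N)%N -> slices k N t ->
  `|expR (- X w) ^+ k - N%:R^-1 * \sum_(j < N) (w \in [set w | X w <= t j])%:R|
    <= N%:R^-1.
Proof.
move=> k0 N0 st; have := layer_cake N0 (expRN_01 k (X0 w)) st.
by under eq_bigr do rewrite (slices_level _ _ st k0).
Qed.

Let bounded_layers N t : bounded_rv
  (fun w => N%:R^-1 * \sum_(j < N) (w \in [set w | X w <= t j])%:R : R).
Proof.
apply: bounded_rvZ; apply: bounded_rv_sum => j; apply: bounded_rv_indic.
exact: measurable_RV_le.
Qed.

Lemma laplace_cdf k N t : (0 < k)%N -> (0 < N)%N -> slices k N t ->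
  `|laplace X k - N%:R^-1 * \sum_(j < N) fine (cdf X (t j))| <= N%:R^-1.
Proof.
move=> k0 N0 st.
pose Z w : R := N%:R^-1 * \sum_(j < N) (w \in [set w | X w <= t j])%:R.
have -> : N%:R^-1 * \sum_(j < N) fine (cdf X (t j)) = mean P Z.
  rewrite meanZ; last first.
    by apply: bounded_rv_sum => j; apply: bounded_rv_indic; exact: measurable_RV_le.
  rewrite mean_sum; last first.
    by move=> j; apply: bounded_rv_indic; exact: measurable_RV_le.
  by congr (_ * _); apply: eq_bigr => j _; rewrite cdfE.
have bY := bounded_rv_laplace k.
have bZ : bounded_rv Z by exact: bounded_layers.
have YZ w := laplace_layer_cake w k0 N0 st.
rewrite ler_distl -[N%:R^-1 in X in X && _](mean_cst P) -[N%:R^-1 in X in _ && X](mean_cst P).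
have bc := bounded_rv_cst (T := T) (N%:R^-1 : R).
rewrite lerBlDr -!meanD //; apply/andP; split; apply: ler_mean => //.
- exact: bounded_rvD.
- by move=> w; have := YZ w; rewrite -/(Z w) ler_distl lerBlDr => /andP[].
- exact: bounded_rvD.
- by move=> w; have := YZ w; rewrite -/(Z w) ler_distl => /andP[].
Qed.

End one.

(** Layer cakes on common levels compare two transforms through finitely many
    values of the distribution functions, at continuity points of the limit. *)
Lemma cvg_laplace (dT_ : nat -> measure_display)
    (T_ : forall n, measurableType (dT_ n)) (P_ : forall n, probability (T_ n) R)
    (X_ : forall n, {RV P_ n >-> R})
    dT (T : measurableType dT) (P : probability T R) (X : {RV P >-> R})
    (F_ : nat -> R -> R) (F : R -> R) k :
  (forall n w, 0 <= X_ n w) -> (forall w, 0 <= X w) ->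
  (forall n t, cdf (X_ n) t = (F_ n t)%:E) -> (forall t, cdf X t = (F t)%:E) ->
  {homo F : x y / x <= y} -> cvg_weakly F_ F ->
  laplace (X_ n) k @[n --> \oo] --> laplace X k.
Proof.
move=> X_0 X0 F_E FE Fnd cF; case: k => [|k].
  have one d' (T' : measurableType d') (P' : probability T' R) (X' : {RV P' >-> R}) :
      laplace X' 0 = 1.
    by rewrite /laplace; under eq_fun do rewrite expr0; exact: mean_cst.
  by rewrite one; under eq_cvg do rewrite one; exact: cvg_cst.
apply/cvgrPdist_lt => e e0.
have [M _ HM] := nbhs_infty_gtr (e / 3)^-1.
pose N := M.+1.
have e3 : 0 < e / 3 by rewrite divr_gt0.
have Ne : N%:R^-1 < e / 3.
  rewrite -[ltRHS]invrK ltf_pV2 ?posrE ?invr_gt0 ?ltr0n //.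
  exact: (HM N (leqnSn M)).
have [t st ct] := exists_slices Fnd (ltn0Sn k) (ltn0Sn M).
have cS : N%:R^-1 * \sum_(j < N) F_ n (t j) @[n --> \oo]
    --> N%:R^-1 * \sum_(j < N) F (t j).
  apply: cvgMr; apply: cvg_big => [|j _]; first exact: add_continuous.
  exact: cF.
have near_S := (cvgrPdist_lt _ _).1 cS _ e3.
near=> n.
have A := laplace_cdf X0 (ltn0Sn k) (ltn0Sn M) st.
have B := laplace_cdf (X_0 n) (ltn0Sn k) (ltn0Sn M) st.
have C : `|N%:R^-1 * \sum_(j < N) F (t j) - N%:R^-1 * \sum_(j < N) F_ n (t j)| < e / 3.
  by near: n; exact: near_S.
move: A B; rewrite -/N.
under eq_bigr do rewrite FE /=; under [in X in _ -> X -> _]eq_bigr do rewrite F_E /=.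
move: C; set u := _ * _; set v := _ * _ => C A B.
rewrite (_ : laplace X k.+1 - _ =
  (laplace X k.+1 - u) + (u - v) + (v - laplace (X_ n) k.+1)); last by ring.
rewrite [ltRHS](_ : e = e / 3 + e / 3 + e / 3); last by field.
apply: le_lt_trans (ler_normD _ _) _; apply: ltrD.
  apply: le_lt_trans (ler_normD _ _) _; apply: ltrD => //.
  exact: le_lt_trans A Ne.
by rewrite distrC; exact: le_lt_trans B Ne.
Unshelve. all: by end_near. Qed.

Section distribution_function.
Context {dT : measure_display} {T : measurableType dT} {P : probability T R}.
Variables (X : {RV P >-> R}) (F : cumulativeBounded (0 : R) (1 : R)).
Hypothesis X0 : forall w, 0 <= X w.
Hypothesis XF : forall t, cdf X t = (F t)%:E.

Let FE t : F t = mean P (fun w => (w \in [set w | X w <= t])%:R).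
Proof. by rewrite -(cdfE X) XF. Qed.

Let bind t : bounded_rv (fun w => (w \in [set w | X w <= t])%:R : R).
Proof. by apply: bounded_rv_indic; exact: measurable_RV_le. Qed.

Lemma laplace_gt0 k : 0 < laplace X k.
Proof.
have [M [_ HM]] := cvgr_gt _ (cumulativey F) _ (ltr01 : 0 < 1 :> R).
have FM : 0 < F (M + 1) by apply: HM; rewrite ltrDl.
apply: (@lt_le_trans _ _ (expR (- (M + 1)) ^+ k * F (M + 1))).
  by rewrite mulr_gt0 // exprn_gt0 // expR_gt0.
rewrite FE -meanZ //; apply: ler_mean => //; first exact: bounded_rvZ.
  exact: bounded_rv_laplace.
move=> w; have [] := boolP (w \in [set w | X w <= M + 1]); last first.
  by rewrite mulr0 exprn_ge0 // expR_ge0.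
by rewrite inE /= mulr1 => le; rewrite lerXn2r ?nnegrE ?expR_ge0 // ler_expR lerN2.
Qed.

Lemma laplace_discount_laplace : laplace_discount (laplace X).
Proof.
split; first split.
- by rewrite /laplace; under eq_fun do rewrite expr0; exact: mean_cst.
- by move=> k; apply: ltW; exact: laplace_gt0.
- move=> k l kl; apply: ler_mean; [exact: bounded_rv_laplace..|move=> w].
  rewrite ler_wiXn2l // ?expR_ge0 // -[leRHS]expR0 ler_expR oppr_le0 //.
- exact: laplace_gt0.
- move=> j k; apply: mean_powM => [|w].
    have := bounded_rv_laplace X0 1; by under eq_fun do rewrite expr1.
  by rewrite expR_gt0 -[leRHS]expR0 ler_expR oppr_le0 X0.
Qed.

Lemma laplace1_lt1 : F 0 < 1 -> laplace X 1 < 1.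
Proof.
move=> F0.
have cF : F x @[x --> 0^'+] --> F 0 by exact: cumulative_is_right_continuous.
have [t t0 Ft] : exists2 t : R, 0 < t & F t < 1.
  have near_F := cvgr_lt _ cF _ F0.
  have : \forall t \near 0^'+, 0 < t /\ F t < 1.
    near=> t; split; first by near: t; exact: nbhs_right_gt.
    by near: t; exact: near_F.
  by move=> /filter_ex[t []]; exists t.
apply: (@le_lt_trans _ _ (expR (- t) + (1 - expR (- t)) * F t)); last first.
  have : expR (- t) < 1 by rewrite -[ltRHS]expR0 ltr_expR oppr_lt0.
  by have := expR_gt0 (- t); nra.
rewrite FE -meanZ // -[X in X + _](mean_cst P) -meanD; last first.
- exact: bounded_rvZ.
- exact: bounded_rv_cst.
apply: ler_mean.
- exact: bounded_rv_laplace.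
- by apply: bounded_rvD; [exact: bounded_rv_cst|exact: bounded_rvZ].
move=> w; rewrite expr1; have [] := boolP (w \in [set w | X w <= t]).
  by rewrite mulr1 addrC subrK -[leRHS]expR0 ler_expR oppr_le0 X0.
by rewrite notin_setE /= mulr0 addr0 ler_expR lerN2 => /negP; rewrite -ltNge => /ltW.
Unshelve. all: by end_near. Qed.

Lemma laplace_le_expr (a : R) k : F a = 0 -> laplace X k <= expR (- a) ^+ k.
Proof.
move=> Fa; rewrite -[leRHS]addr0 -Fa FE -[X in X + _](mean_cst P) -meanD //; last first.
  exact: bounded_rv_cst.
apply: ler_mean; first exact: bounded_rv_laplace.
  by apply: bounded_rvD => //; exact: bounded_rv_cst.
move=> w; have [] := boolP (w \in [set w | X w <= a]).
  by case/andP: (expRN_01 k (X0 w)) => _ le1; rewrite ler_wpDl // exprn_ge0 // expR_ge0.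
rewrite notin_setE /= addr0 => /negP; rewrite -ltNge => /ltW aX.
by rewrite lerXn2r ?nnegrE ?expR_ge0 // ler_expR lerN2.
Qed.

End distribution_function.
End laplace.

(** * Independence *)

Section independence.
Context {R : realType} {I : choiceType}.
Context {dT : measure_display} {T : measurableType dT} {P : probability T R}.
Variable X : I -> {RV P >-> R}.
Hypothesis X0 : forall i w, 0 <= X i w.
Hypothesis Xind : mutually_independent X.

Lemma prod_indic (s : seq I) (A : I -> set T) w :
  \prod_(i <- s) (w \in A i)%:R =
  (w \in [set w | forall i, i \in s -> A i w])%:R :> R.
Proof.
elim: s => [|i s IH].
  have w0 : w \in [set w | forall i, i \in [::] -> A i w] by apply/mem_set.
  by rewrite big_nil w0.
rewrite big_cons IH -natrM mulnb; congr (nat_of_bool _)%:R.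
apply/andP/idP => [[]|]; rewrite !inE /=.
  by move=> wi ws j; rewrite in_cons => /predU1P[->|/ws].
by move=> ws; split => [|j js]; apply: ws; rewrite in_cons ?eqxx ?js ?orbT.
Qed.

Let mpre i (B : set R) : measurable B -> measurable [set w | B (X i w)].
Proof.
move=> mB; have mX : measurable_fun [set: T] (X i) by exact: measurable_funPT.
by rewrite -[X in measurable X]setTI; exact: (mX measurableT).
Qed.

(** Independence is given for events.  Mixed products of indicators and layer cakes
    allow an induction that expands one layer cake at a time into indicators. *)
Let mean_layers N (t : I -> nat -> R) (r2 r1 : seq I) (B : I -> set R) :
  uniq (r1 ++ r2) -> (forall i, measurable (B i)) ->
  mean P (fun w => \prod_(i <- r1) (w \in [set w | B i (X i w)])%:R *
    \prod_(i <- r2) (N%:R^-1 * \sum_(j < N) (w \in [set w | X i w <= t i j])%:R)) =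
  \prod_(i <- r1) fine (P [set w | B i (X i w)]) *
  \prod_(i <- r2) mean P
    (fun w => N%:R^-1 * \sum_(j < N) (w \in [set w | X i w <= t i j])%:R).
Proof.
have bB B' i : measurable (B' : set R) ->
    bounded_rv (fun w => (w \in [set w | B' (X i w)])%:R : R).
  by move=> mB'; apply: bounded_rv_indic; exact: mpre.
have bt i j : bounded_rv (fun w => (w \in [set w | X i w <= t i j])%:R : R).
  by apply: bounded_rv_indic; exact: measurable_RV_le.
have bZ i : bounded_rv
    (fun w => N%:R^-1 * \sum_(j < N) (w \in [set w | X i w <= t i j])%:R : R).
  by apply: bounded_rvZ; apply: bounded_rv_sum => j.
elim: r2 r1 B => [|z r2 IH] r1 B u mB.
  rewrite cats0 in u; rewrite big_nil mulr1 -Xind // -mean_indic; last first.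
    have -> : [set w | forall i, i \in r1 -> B i (X i w)] =
        \bigcap_(i in [set` r1]) [set w | B i (X i w)].
      by apply/seteqP; split => w /= H i; exact: H.
    by apply: fin_bigcap_measurable => // i _; exact: mpre.
  congr mean; apply/funext => w.
  by rewrite big_nil mulr1 (prod_indic r1 (fun i => [set w | B i (X i w)])).
have zr1 : z \notin r1.
  by move: u; rewrite cat_uniq => /and3P[_ /hasPn H _]; apply: (H z); rewrite mem_head.
pose B' j i := if i == z then [set x : R | x <= t z j] else B i.
have mB' j i : measurable (B' j i).
  rewrite /B'; case: eqP => // _.
  have -> : [set x : R | x <= t z j] = `]-oo, t z j]%classic.
    by apply/seteqP; split => x /=; rewrite in_itv.
  exact: measurable_itv.
have u' : uniq ((z :: r1) ++ r2).
  by move: u; rewrite -cat_rcons -!cats1 -!catA !(uniq_catCA _ [:: z]).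
pose W w := \prod_(i <- r2)
  (N%:R^-1 * \sum_(j < N) (w \in [set w | X i w <= t i j])%:R) : R.
have bW : bounded_rv W by apply: bounded_rv_prod.
have key (j : 'I_N) := IH (z :: r1) (B' j) u' (mB' j).
have B'E j i : i \in r1 -> B' j i = B i.
  by move=> ir; rewrite /B'; case: eqP => // iz; rewrite -iz ir in zr1.
have B'z j : [set w | B' j z (X z w)] = [set w | X z w <= t z j].
  by rewrite /B' eqxx.
pose V w := \prod_(i <- r1) (w \in [set w | B i (X i w)])%:R : R.
have bV : bounded_rv V by apply: bounded_rv_prod => i; exact: bB.
transitivity (mean P (fun w => \sum_(j < N) N%:R^-1 *
    ((w \in [set w | X z w <= t z j])%:R * V w * W w))).
  congr mean; apply/funext => w; rewrite big_cons -/(W w) -/(V w).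
  by rewrite -mulr_sumr -!mulr_suml; ring.
rewrite mean_sum; last first.
  by move=> j; apply: bounded_rvZ; apply: bounded_rvM => //; exact: bounded_rvM.
rewrite big_cons meanZ; last by apply: bounded_rv_sum => j.
rewrite mean_sum //; set p := \prod_(i <- r1) _; set q := \prod_(i <- r2) _.
set c := fun j : 'I_N => mean P (fun w => (w \in [set w | X z w <= t z j])%:R).
rewrite -[\sum_(j < N) mean P (fun w => _ %:R)]/(\sum_(j < N) c j).
have -> : p * (N%:R^-1 * (\sum_(j < N) c j) * q) = \sum_(j < N) N%:R^-1 * (c j * p * q).
  by rewrite -mulr_sumr -!mulr_suml; ring.
apply: eq_bigr => j _; rewrite /c /p /q {c p q}.
rewrite meanZ; last by apply: bounded_rvM => //; exact: bounded_rvM.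
congr (_ * _).
have pE : \prod_(i <- r1) fine (P [set w | B' j i (X i w)]) =
    \prod_(i <- r1) fine (P [set w | B i (X i w)]).
  by rewrite !big_seq; apply: eq_bigr => i ir; rewrite B'E.
have := key j; rewrite big_cons pE B'z -mean_indic; last exact: measurable_RV_le.
move=> <-; congr mean; apply/funext => w.
rewrite big_cons B'z -/(W w); congr (_ * _ * _).
by rewrite /V !big_seq; apply: eq_bigr => i ir; rewrite B'E.
Qed.

Lemma prod_dist (r : seq I) (f g : I -> R) (e : R) :
  (forall i, 0 <= f i <= 1) -> (forall i, 0 <= g i <= 1) ->
  (forall i, i \in r -> `|f i - g i| <= e) ->
  `|\prod_(i <- r) f i - \prod_(i <- r) g i| <= (size r)%:R * e.
Proof.
move=> f01 g01; elim: r => [|i r IH] fg; first by rewrite !big_nil subrr normr0 mul0r.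
rewrite !big_cons.
set u := \prod_(j <- r) f j; set v := \prod_(j <- r) g j.
have v01 : 0 <= v <= 1.
  rewrite /v; elim: (r) => [|j s /andP[s0 s1]]; first by rewrite big_nil ler01 lexx.
  by rewrite big_cons; have /andP[a b] := g01 j; rewrite mulr_ge0 ?mulr_ile1.
have -> : f i * u - g i * v = f i * (u - v) + (f i - g i) * v by ring.
apply: le_trans (ler_normD _ _) _; rewrite !normrM -natr1 mulrDl mul1r.
have /andP[a b] := f01 i; have /andP[c d] := v01.
rewrite [`|f i|]ger0_norm // [`|v|]ger0_norm //.
apply: lerD.
  apply: le_trans (ler_piMl _ b) _; first exact: normr_ge0.
  by apply: IH => j jr; apply: fg; rewrite in_cons jr orbT.
apply: le_trans (ler_piMr _ d) _; first exact: normr_ge0.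
by apply: fg; rewrite mem_head.
Qed.

(** Each factor is within [1 / N] of a layer cake, uniformly in the sample. *)
Lemma mean_prod_laplace (r : seq I) (k : I -> nat) : uniq r ->
  (forall i, (0 < k i)%N) ->
  mean P (fun w => \prod_(i <- r) expR (- X i w) ^+ k i) =
  \prod_(i <- r) laplace (X i) (k i).
Proof.
move=> ur k0; apply: (@eq_of_invn _ _ _ (2 * (size r)%:R)) => N N0.
have ex i : exists t : nat -> R, slices (k i) N t.
  have [t st _] := exists_slices (F := fun _ : R => 0 : R) (fun _ _ _ => lexx _) (k0 i) N0.
  by exists t.
have [t ht] := choice ex.
pose Z i w : R := N%:R^-1 * \sum_(j < N) (w \in [set w | X i w <= t i j])%:R.
have N0' : 0 < N%:R :> R by rewrite ltr0n.
have Z01 i w : 0 <= Z i w <= 1.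
  rewrite /Z mulr_ge0 ?invr_ge0 ?sumr_ge0 //= mulrC ler_pdivrMr // mul1r.
  apply: le_trans (_ : \sum_(j < N) 1 <= _); first by apply: ler_sum => j _; case: (_ \in _).
  by rewrite sumr_const card_ord.
have bZ i : bounded_rv (Z i).
  apply: bounded_rvZ; apply: bounded_rv_sum => j; apply: bounded_rv_indic.
  exact: measurable_RV_le.
have YZ i w : `|expR (- X i w) ^+ k i - Z i w| <= N%:R^-1.
  exact: laplace_layer_cake.
have mE : mean P (fun w => \prod_(i <- r) Z i w) = \prod_(i <- r) mean P (Z i).
  have := @mean_layers N t r [::] (fun _ => setT) ur (fun _ => measurableT).
  rewrite big_nil mul1r => <-; congr mean; apply/funext => w.
  by rewrite big_nil mul1r.
set a := mean P _; set b := \prod_(i <- r) _; set m := mean P _ in mE.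
have am : `|a - m| <= (size r)%:R * N%:R^-1.
  have H w := prod_dist (fun i => expRN_01 (k i) (X0 i w)) (fun i => Z01 i w)
    (fun i (_ : i \in r) => YZ i w).
  have bY : bounded_rv (fun w => \prod_(i <- r) expR (- X i w) ^+ k i).
    by apply: bounded_rv_prod => i; exact: bounded_rv_laplace.
  have bm : bounded_rv (fun w => \prod_(i <- r) Z i w) by exact: bounded_rv_prod.
  have bc := bounded_rv_cst (T := T) ((size r)%:R * N%:R^-1 : R).
  rewrite ler_distl -[_ * _ in X in X && _](mean_cst P) -[_ * _ in X in _ && X](mean_cst P).
  rewrite lerBlDr -!meanD //; apply/andP; split; apply: ler_mean => //.
  - exact: bounded_rvD.
  - by move=> w; have := H w; rewrite ler_distl lerBlDr => /andP[].
  - exact: bounded_rvD.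
  - by move=> w; have := H w; rewrite ler_distl => /andP[].
have mb : `|m - b| <= (size r)%:R * N%:R^-1.
  rewrite mE distrC; apply: prod_dist => i.
  - have bY := bounded_rv_laplace (X0 i) (k i).
    apply/andP; split.
      by apply: mean_ge0 => w; case/andP: (expRN_01 (k i) (X0 i w)).
    rewrite -[leRHS](mean_cst P); apply: ler_mean => //; first exact: bounded_rv_cst.
    by move=> w; case/andP: (expRN_01 (k i) (X0 i w)).
  - apply/andP; split; first by apply: mean_ge0 => w; case/andP: (Z01 i w).
    rewrite -[leRHS](mean_cst P); apply: ler_mean => //; first exact: bounded_rv_cst.
    by move=> w; case/andP: (Z01 i w).
  - move=> _; have := laplace_cdf (X0 i) (k0 i) N0 (ht i).
    rewrite meanZ; last first.
      by apply: bounded_rv_sum => j; apply: bounded_rv_indic; exact: measurable_RV_le.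
    rewrite mean_sum; last first.
      by move=> j; apply: bounded_rv_indic; exact: measurable_RV_le.
    by under eq_bigr do rewrite cdfE.
have -> : a - b = (a - m) + (m - b) by rewrite subrKA.
apply: le_trans (ler_normD _ _) _; apply: le_trans (lerD am mb) _.
by rewrite -mulrA; lra.
Qed.

End independence.

(** * From the walk and the potential to words *)

Lemma measurable_countable (R : realType) dT (T : measurableType dT) (C : countType)
    (f : T -> C) (A : set C) :
  (forall c, measurable [set w | f w = c]) -> measurable [set w | A (f w)].
Proof.
move=> mf.
have -> : [set w | A (f w)] =
    \bigcup_n [set w | A (f w) /\ pickle (f w) = n].
  by apply/seteqP; split => w /= => [Aw|[n _ []//]]; exists (pickle (f w)).
apply: bigcupT_measurable => n.
have [[c [Ac cn]]|noc] := pselect (exists c, A c /\ pickle c = n).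
  have -> : [set w | A (f w) /\ pickle (f w) = n] = [set w | f w = c].
    apply/seteqP; split => w /=; last by move=> ->.
    by move=> [_ fn]; apply: (pcan_inj pickleK); rewrite fn cn.
  exact: mf.
have -> : [set w | A (f w) /\ pickle (f w) = n] = set0; last exact: measurable0.
by apply/seteqP; split => w //= Aw; apply: noc; exists (f w).
Qed.

Lemma prob_setI_full (R : realType) dT (T : measurableType dT) (P : probability T R)
    (A B : set T) : measurable A -> measurable B -> P A = 1%E -> P (A `&` B) = P B.
Proof.
move=> mA mB PA; rewrite [RHS](measureDI P mB mA) setIC.
rewrite [X in _ = (X + _)%E](_ : _ = 0%E) ?add0e //.
apply: (@subset_measure0 _ _ _ P _ (~` A)).
- exact: measurableD.
- exact: measurableC.
- by move=> w [].
- by rewrite [LHS](probability_setC P mA) PA subee.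
Qed.

Lemma step_vec_inj d : injective (@step_vec d).
Proof.
have key (i j : 'I_d) : delta_mx 0 i = delta_mx 0 j :> 'rV[int]_d -> i = j.
  move=> /rowP /(_ i); rewrite !mxE !eqxx /=; case: eqP => //.
have key' (i j : 'I_d) : delta_mx 0 i <> - delta_mx 0 j :> 'rV[int]_d.
  by move=> /rowP /(_ i); rewrite !mxE !eqxx /=; case: eqP.
move=> [i b] [j c]; rewrite /step_vec /=; case: b; case: c.
- by move=> /oppr_inj /key ->.
- by move=> /esym /key'.
- by move=> /key'.
- by move=> /key ->.
Qed.

Lemma srw_step_vec (R : realType) d (u : step d) :
  srw_step R (step_vec u) = (2 * d%:R)^-1.
Proof.
rewrite /srw_step (_ : [exists i, _] = true) //; apply/existsP; exists u.1.
by rewrite /step_vec; case: u.2; rewrite eqxx ?orbT.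
Qed.

Lemma follow d (p : nat -> 'rV[int]_d) (s : seq (step d)) (x : 'rV[int]_d) :
  p 0%N = x ->
  (forall i, (i < size s)%N -> p i.+1 - p i = nth 0 [seq step_vec u | u <- s] i) ->
  trace x s = [seq p i | i <- iota 0 (size s)] /\ dest x s = p (size s).
Proof.
elim: s p x => [|u s IH] p x p0 ps //=.
have [|i si|tE dE] := IH (fun i => p i.+1) (x + step_vec u).
- by rewrite -p0 addrC -[step_vec u]/(nth 0 [seq step_vec u | u <- u :: s] 0) -ps // subrK.
- exact: (ps i.+1 si).
rewrite tE dE p0; split => //; congr cons.
by rewrite (iotaDl 1 0) -map_comp.
Qed.

Section walk.
Context {R : realType} {d : nat}.
Hypothesis d0 : (0 < d)%N.
Variable W : srw R d.
Variables (v : 'rV[int]_d -> R) (y : 'rV[int]_d).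
Hypothesis v0 : forall z, 0 <= v z.

Let P := walk_law W 0.
Let pos := @walk_pos R d W.

(** The survival variable on the event that the first visit to [y] is at time [n],
    written as a product of functions of single positions, which are measurable
    although only singletons of the lattice are known to be. *)
Let hit_at n w : R := (pos n w == y)%:R *
  \prod_(m < n) ((pos m w != y)%:R * expR (- v (pos m w))).

Let bounded_site m (f : 'rV[int]_d -> R) : (forall z, 0 <= f z <= 1) ->
  bounded_rv (fun w => f (pos m w)).
Proof.
move=> f01; split; last first.
  by exists 1 => w; case/andP: (f01 (pos m w)) => a b; rewrite ger0_norm.
move=> _ B mB; rewrite setTI.
apply: (@measurable_countable R _ _ _ (pos m) (fun z => B (f z))) => c.
exact: walk_measurable.
Qed.

Let factor01 z : 0 <= (z != y)%:R * expR (- v z) <= 1.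
Proof.
rewrite mulr_ge0 ?expR_ge0 ?ler0n //= mulr_ile1 ?expR_ge0 ?ler0n //.
  by case: (z != y).
by rewrite -[leRHS]expR0 ler_expR oppr_le0.
Qed.

Let bounded_hit_at n : bounded_rv (hit_at n).
Proof.
apply: bounded_rvM.
  apply: (@bounded_site n (fun z => (z == y)%:R)) => z.
  by case: (z == y); rewrite ?lexx ler01.
apply: bounded_rv_prod => m.
exact: (@bounded_site m (fun z => (z != y)%:R * expR (- v z))).
Qed.

Let hit_at_ge0 n w : 0 <= hit_at n w.
Proof. by rewrite mulr_ge0 // prodr_ge0 // => m _; case/andP: (factor01 (pos m w)). Qed.

Let hit_at_le1 n w : hit_at n w <= 1.
Proof.
rewrite /hit_at mulr_ile1 ?prodr_ile1 //.
- by apply: prodr_ge0 => m _; case/andP: (factor01 (pos m w)).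
- by case: (_ == _).
Qed.

Let follows n (s : n.-tuple (step d)) : set (walk_space W) :=
  [set w | pos 0 w = 0] `&`
  [set w | forall i : 'I_n, pos i.+1 w - pos i w = nth 0 [seq step_vec u | u <- s] i].

Let measurable_incr n (u : 'I_n -> 'rV[int]_d) :
  measurable [set w | forall i : 'I_n, pos i.+1 w - pos i w = u i].
Proof.
have -> : [set w | forall i : 'I_n, pos i.+1 w - pos i w = u i] =
    \bigcap_(i in [set: 'I_n]) [set w | pos i.+1 w - pos i w = u i].
  by apply/seteqP; split => w /= H i; [move=> _|]; apply: H.
apply: fin_bigcap_measurable => // i _.
apply: (@measurable_countable R _ _ _ (fun w => (pos i.+1 w, pos i w))
  (fun p => p.1 - p.2 = u i)) => -[a b].
have -> : [set w | (pos i.+1 w, pos i w) = (a, b)] =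
    [set w | pos i.+1 w = a] `&` [set w | pos i w = b].
  by apply/seteqP; split => w /= => [[-> ->]|[-> ->]].
by apply: measurableI; exact: walk_measurable.
Qed.

Let measurable_follows n (s : n.-tuple (step d)) : measurable (follows s).
Proof. by apply: measurableI; [exact: walk_measurable|exact: measurable_incr]. Qed.

Let prob_follows n (s : n.-tuple (step d)) :
  fine (P (follows s)) = (2 * d%:R)^-1 ^+ n.
Proof.
have -> : P (follows s) = P [set w | forall i : 'I_n,
    pos i.+1 w - pos i w = nth 0 [seq step_vec u | u <- s] i].
  apply: prob_setI_full; [exact: walk_measurable|exact: measurable_incr|].
  exact: walk_start.
rewrite walk_steps /=.
rewrite (eq_bigr (fun _ => (2 * d%:R)^-1)) ?prodr_const ?card_ord // => i _.
rewrite -(srw_step_vec R (tnth s i)); congr srw_step.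
have i0 : (i < size s)%N by rewrite size_tuple.
rewrite (nth_map (tnth s i)) //; congr step_vec.
by rewrite -tnth_nth.
Qed.

Let hit_at_follows n (s : n.-tuple (step d)) w : follows s w ->
  hit_at n w = (first_hit 0 y s)%:R * expR (- \sum_(z <- trace 0 s) v z).
Proof.
move=> [w0 ws].
have [|i|tE dE] := @follow d (fun i => pos i w) s 0; first by [].
  by rewrite size_tuple => si; exact: (ws (Ordinal si)).
rewrite size_tuple in tE dE.
rewrite /first_hit dE tE /hit_at big_split /= big_map -mulnb natrM -mulrA.
congr (_ * _); congr (_ * _).
  rewrite -[LHS](big_mkord xpredT (fun i => (pos i w != y)%:R)) /=.
  rewrite /index_iota subn0; elim: (iota 0 n) => [|i r IH]; first by rewrite big_nil.
  by rewrite big_cons /= in_cons negb_or eq_sym -mulnb natrM IH.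
rewrite -[LHS](big_mkord xpredT (fun i => expR (- v (pos i w)))) /=.
rewrite /index_iota subn0; elim: (iota 0 n) => [|i r IH].
  by rewrite !big_nil oppr0 expR0.
by rewrite !big_cons opprD expRD IH.
Qed.

Let follows_inj n (s t : n.-tuple (step d)) w : follows s w -> follows t w -> s = t.
Proof.
move=> [_ ws] [_ wt]; apply: val_inj; apply: (inj_map (@step_vec_inj d)).
apply: (@eq_from_nth _ 0); rewrite !size_map !size_tuple // => i si.
by rewrite -(ws (Ordinal si)) -(wt (Ordinal si)).
Qed.

(** The events of following the words of length [n] are disjoint and have total
    probability one, so that trajectories with other increments are negligible. *)
Let mean_hit_at n : mean P (hit_at n) =
  avg n (fun s => (first_hit 0 y s)%:R * expR (- \sum_(z <- trace 0 s) v z)).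
Proof.
rewrite avg_tuple.
pose F (s : n.-tuple (step d)) : R :=
  (first_hit 0 y s)%:R * expR (- \sum_(z <- trace 0 s) v z).
pose B w : R := \sum_(s : n.-tuple (step d)) (w \in follows s)%:R.
have bA s : bounded_rv (fun w => (w \in @follows n s)%:R : R).
  exact: bounded_rv_indic.
have bB : bounded_rv B by apply: bounded_rv_sum.
have B1 w : B w <= 1.
  rewrite /B (eq_bigr (fun s => (w \in follows s)%:R * 1)) => [|s _]; last first.
    by rewrite mulr1.
  apply: sum_unique_le => // s t; rewrite !inE; exact: follows_inj.
have mB : mean P B = 1.
  rewrite mean_sum // (eq_bigr (fun _ => (2 * d%:R)^-1 ^+ n)) => [|s _]; last first.
    by rewrite mean_indic // prob_follows.
  rewrite -[RHS](avg1 (R := R) n d0) avg_tuple mulr_sumr.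
  by apply: eq_bigr => s _; rewrite mulr1.
pose G w : R := \sum_(s : n.-tuple (step d)) F s * (w \in follows s)%:R.
have GE w : G w = hit_at n w * B w.
  rewrite /B mulr_sumr; apply: eq_bigr => s _.
  have [|] := boolP (w \in follows s); last by rewrite !mulr0.
  by rewrite inE => ws; rewrite (hit_at_follows ws).
have bG : bounded_rv G by apply: bounded_rv_sum => s; exact: bounded_rvZ.
have -> : mean P (hit_at n) = mean P G.
  apply/eqP; rewrite eq_le; apply/andP; split; last first.
    apply: ler_mean => // w; rewrite GE ler_piMr //.
  have bC : bounded_rv (fun w => G w + (1 + -1 * B w)).
    apply: bounded_rvD => //; apply: bounded_rvD; first exact: bounded_rv_cst.
    exact: bounded_rvZ.
  apply: (@le_trans _ _ (mean P (fun w => G w + (1 + -1 * B w)))).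
    apply: ler_mean => // w; rewrite GE.
    have := B1 w; have := hit_at_le1 n w; have := hit_at_ge0 n w.
    by nra.
  rewrite meanD //; last first.
    by apply: bounded_rvD; [exact: bounded_rv_cst|exact: bounded_rvZ].
  rewrite meanD ?meanZ ?mean_cst ?mB //; [lra|exact: bounded_rv_cst|exact: bounded_rvZ].
rewrite mean_sum => [|s]; last exact: bounded_rvZ.
rewrite mulr_sumr; apply: eq_bigr => s _.
by rewrite meanZ // mean_indic // prob_follows mulrC.
Qed.

Let survival_series w :
  (survival v (fun n => pos n w) y)%:E = (\sum_(n <oo) (hit_at n w)%:E)%E.
Proof.
have S0 n : (0 <= (hit_at n w)%:E)%E by rewrite lee_fin.
rewrite /survival /hitting_time; case: pselect => [ex|noex]; last first.
  rewrite eseries0 // => n _ _; rewrite /hit_at (_ : (pos n w == y) = false) ?mul0r //.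
  by apply/negP => E; apply: noex; exists n.
case: ex_minnP => h /= hy hmin.
rewrite (nneseriesD1 (n := h)) // eseries0 => [|n _ /andP[_ nh]]; last first.
  have [nlh|hln|E] := ltngtP n h; last by rewrite E eqxx in nh.
    rewrite /hit_at (_ : (pos n w == y) = false) ?mul0r //.
    by apply/negP => /hmin; rewrite leqNgt nlh.
  by rewrite /hit_at (bigD1 (Ordinal hln)) //= hy mul0r mul0r mulr0.
rewrite adde0; congr EFin; rewrite /hit_at hy mul1r.
rewrite -sumrN expR_sum; apply: eq_bigr => m _.
rewrite (_ : pos m w != y) ?mul1r //.
by apply/negP => /hmin; rewrite leqNgt ltn_ord.
Qed.

Lemma expectation_survival :
  ('E_P[fun w => survival v (fun n => pos n w) y] =
  \sum_(n <oo) (avg n (fun s => (first_hit 0 y s)%:R *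
    expR (- \sum_(z <- trace 0 s) v z)))%:E)%E.
Proof.
rewrite unlock; under eq_integral do rewrite survival_series.
rewrite integral_nneseries //=; last 2 first.
- by move=> n; apply/measurable_realfun.measurable_EFinP; case: (bounded_hit_at n).
- by move=> n w _; rewrite lee_fin.
by apply: eq_eseriesr => n _; rewrite -mean_hit_at EFin_mean.
Qed.

Lemma travel_weight_series :
  (travel_weight W v 0 y)%:E = (\sum_(n <oo) (avg n (fun s => (first_hit 0 y s)%:R *
    expR (- \sum_(z <- trace 0 s) v z)))%:E)%E.
Proof.
rewrite /travel_weight expectation_survival fineK //.
have a0 n : 0 <= avg n (fun s => (first_hit 0 y s)%:R *
    expR (- \sum_(z <- trace 0 s) v z)).
  by apply: avg_ge0 => s _; rewrite mulr_ge0 // expR_ge0.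
rewrite ge0_fin_numE; last by apply: nneseries_ge0 => n _ _; rewrite lee_fin.
apply: (@le_lt_trans _ _ 1%E); last exact: ltry.
apply: lime_le; first by apply: is_cvg_nneseries => n _ _; rewrite lee_fin.
apply: nearW => N; rewrite big_mkord sumEFin lee_fin.
apply: le_trans (passage_le1 N 0 y d0).
apply: ler_passage => s _ _.
by rewrite -[leRHS]expR0 ler_expR oppr_le0 sumr_ge0.
Qed.

End walk.

(** * The exponent of the model *)

Section annealed.
Context {R : realType} {d : nat}.
Hypothesis d0 : (0 < d)%N.
Variables (F : cumulativeBounded (0 : R) (1 : R)) (V : iid_potential d F).

Let V0 z w : 0 <= pot V z w := pot_ge0 z w.

(** The distribution function determines the transform: [cvg_laplace] for a
    constant sequence. *)
Lemma laplace_site z k : laplace (pot V z) k = laplace (pot V 0) k.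
Proof.
have Fnd : {homo F : s t / s <= t} by exact: cumulative_is_nondecreasing.
have cF : cvg_weakly (fun _ : nat => F : R -> R) F by move=> t _; exact: cvg_cst.
have := cvg_laplace (X_ := fun _ : nat => pot V z) (k := k) (fun _ => V0 z) (V0 0)
  (fun _ => pot_cdf V z) (pot_cdf V 0) Fnd cF.
by move/(cvg_lim (@Rhausdorff R)) => <-; rewrite lim_cst.
Qed.

(** Repeated visits to a site meet the same value of the potential, and different
    sites are independent. *)
Lemma mean_path (l : seq 'rV[int]_d) :
  mean (pot_law V) (fun w => expR (- \sum_(z <- l) pot V z w)) =
  weight (fun _ => laplace (pot V 0)) l.
Proof.
(* [mean_prod_laplace] asks for positive exponents at all sites *)
pose k z := maxn 1 (count_mem z l).
have kE z : z \in undup l -> k z = count_mem z l.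
  by rewrite mem_undup -has_pred1 has_count => c0; apply/maxn_idPr.
transitivity (mean (pot_law V) (fun w => \prod_(z <- undup l) expR (- pot V z w) ^+ k z)).
  congr mean; apply/funext => w; rewrite -sumrN expR_sum -prodr_undup_exp_count.
  by rewrite !big_seq; apply: eq_bigr => z zl; rewrite kE.
rewrite (mean_prod_laplace V0 (@pot_independent _ _ _ V)) ?undup_uniq //; last first.
  by move=> z; rewrite leq_max.
by rewrite /weight !big_seq; apply: eq_bigr => z zl; rewrite laplace_site kE.
Qed.

Let bounded_path (l : seq 'rV[int]_d) :
  bounded_rv (fun w => expR (- \sum_(z <- l) pot V z w)).
Proof.
rewrite (_ : (fun w => _) = (fun w => \prod_(z <- l) expR (- pot V z w) ^+ 1)).
  by apply: bounded_rv_prod => z; exact: bounded_rv_laplace.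
apply/funext => w; rewrite -sumrN expR_sum.
by apply: eq_bigr => z _; rewrite expr1.
Qed.

Let visit_mass n y w : R := avg n (fun s => (first_hit 0 y s)%:R *
  expR (- \sum_(z <- trace 0 s) pot V z w)).

Let bounded_visit_mass n y : bounded_rv (visit_mass n y).
Proof.
rewrite /visit_mass; under eq_fun do rewrite avg_tuple.
apply: bounded_rvZ; apply: bounded_rv_sum => s; apply: bounded_rvZ.
exact: bounded_path.
Qed.

Let mean_visit_mass n y : mean (pot_law V) (visit_mass n y) =
  avg n (fun s => (first_hit 0 y s)%:R * path_weight (laplace (pot V 0)) 0 s).
Proof.
rewrite /visit_mass; under eq_fun do rewrite avg_tuple.
have bF (s : n.-tuple (step d)) : bounded_rv (fun w =>
    (first_hit 0 y s)%:R * expR (- \sum_(z <- trace 0 s) pot V z w)).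
  by apply: bounded_rvZ; exact: bounded_path.
rewrite meanZ; last exact: bounded_rv_sum.
rewrite avg_tuple mean_sum //; congr (_ * _); apply: eq_bigr => s _.
by rewrite meanZ ?mean_path.
Qed.

Lemma annealed_costE (W : srw R d) y :
  annealed_cost W V 0 y = - ln (mass (laplace (pot V 0)) y).
Proof.
rewrite /annealed_cost; congr (- ln _).
have gc : discount (laplace (pot V 0)).
  by case: (laplace_discount_laplace (V0 0) (pot_cdf V 0)).
rewrite unlock; under eq_integral do rewrite travel_weight_series //.
have v0 n w : 0 <= visit_mass n y w.
  by apply: avg_ge0 => s _; rewrite mulr_ge0 // expR_ge0.
rewrite integral_nneseries //=; last 2 first.
- move=> n; apply/measurable_realfun.measurable_EFinP.
  by case: (bounded_visit_mass n y).
- by move=> n w _; rewrite lee_fin; exact: v0.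
rewrite (_ : limn _ = (mass (laplace (pot V 0)) y)%:E) //.
rewrite /mass -EFin_lim; last exact: is_cvg_mass.
congr (limn _); apply/funext => N /=.
rewrite big_mkord -sumEFin; apply: eq_bigr => n _.
by rewrite -mean_visit_mass EFin_mean.
Qed.

Lemma annealed_lyapunovE (W : srw R d) x :
  annealed_lyapunov W V x = lyapunov (laplace (pot V 0)) x.
Proof. by rewrite /annealed_lyapunov; under eq_fun do rewrite annealed_costE. Qed.

End annealed.

Theorem theorem2 (R : realType) (d : nat) (hd : (1 <= d)%N)
    (W : srw R d)
    (F_ : nat -> cumulativeBounded (0 : R) (1 : R))
    (F : cumulativeBounded (0 : R) (1 : R))
    (V_ : forall n : nat, iid_potential d (F_ n))
    (V : iid_potential d F)
    (hF_ : forall n : nat, in_D (F_ n))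
    (hw : cvg_weakly (fun n : nat => F_ n : R -> R) F)
    (hF : in_D F)
    (hF1 : lebesgue_stieltjes_measure F `[0, +oo[ = 1%E)
    (hd2 : d = 2%N ->
      exists lambda : R, 0 < lambda /\ forall n : nat, F_ n lambda = 0)
    (x : 'rV[int]_d) :
  annealed_lyapunov W (V_ n) x @[n --> \oo] --> annealed_lyapunov W V x.
Proof.
rewrite annealed_lyapunovE //; under eq_cvg do rewrite annealed_lyapunovE //.
have Vn0 n := @pot_ge0 _ _ _ (V_ n) 0; have V0 := @pot_ge0 _ _ _ V 0.
apply: lyapunov_continuous => //.
- by move=> n; exact: laplace_discount_laplace (Vn0 n) (pot_cdf (V_ n) 0).
- exact: laplace_discount_laplace V0 (pot_cdf V 0).
- by case: hF => _; exact: laplace1_lt1 V0 (pot_cdf V 0).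
- move=> k; apply: (cvg_laplace (X_ := fun n => pot (V_ n) 0) (k := k) Vn0 V0
    (fun n => pot_cdf (V_ n) 0) (pot_cdf V 0) _ hw).
  exact: cumulative_is_nondecreasing.
move=> /hd2 [lambda [lambda0 hlambda]]; exists (expR (- lambda)).
  by rewrite expR_gt0 -[ltRHS]expR0 ltr_expR oppr_lt0.
by move=> n k; apply: laplace_le_expr (Vn0 n) (pot_cdf (V_ n) 0) _ _ _.
Qed.
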